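(* Assume (A1) $\mathbb{E}X(1)=\mu=(\mu_1,\mu_2)$ with $\mu_1<0$, $\mu_2<0$; (A2) $r_1|\mu_1|>|\mu_2|$ and $r_2|\mu_2|>|\mu_1|$; (A3) for $(i,j)=(1,2)$ and for $(i,j)=(2,1)$, $\mathbb{P}\{\exists\, t>0:\ X_i(t)>0,\ X_j(t)=\underline{X}_j(t)\}>0$, where $\underline{X}_j(t)=\inf_{0\le s\le t}X_j(s)$. Then for every $(u,v)\in[0,\infty)^2$ $$p_1(u,v)\in(0,1)\qquad\text{and}\qquad p_1(u,v)+p_2(u,v)=1.$$ Moreover, $\lim_{u\to\infty}p_1(u,v)=1$ for each fixed $v\ge 0$, and $\lim_{v\to\infty}p_1(u,v)=0$ for each fixed $u\ge 0$.
   Context: $X=(X_1,X_2)$ is a bivariate Lévy process with càdlàg paths, adapted to a filtration $(\mathcal{F}_t)_{t\ge0}$, and $r_1,r_2>0$ are constants. For a starting position $(u,v)\in[0,\infty)^2$, the reflected process $Y=(Y_1,Y_2)$ with $Y_1,Y_2\ge 0$ and the regulators $L_1,L_2$ are adapted processes such that a.s. for all $t\ge0$ $$Y_1(t)=u+X_1(t)+L_1(t)+r_2L_2(t),\qquad Y_2(t)=v+X_2(t)+r_1L_1(t)+L_2(t),$$ where each $L_i$ is non-decreasing, $L_i(0)=0$, and $\int_0^\infty Y_i(s)\,dL_i(s)=0$. (Solutions need not be unique.) Standing assumption: for every starting position $(u,v)\in[0,\infty)^2$ an adapted process $Y=(Y_1,Y_2)$ with $Y_1,Y_2\ge0$, together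 with adapted non-decreasing regulators $L_1,L_2$ with $L_i(0)=0$ and $\int_0^\infty Y_i(s)\,dL_i(s)=0$, satisfying a.s. for all $t\ge0$ the equations $Y_1(t)=u+X_1(t)+L_1(t)+r_2L_2(t)$ and $Y_2(t)=v+X_2(t)+r_1L_1(t)+L_2(t)$, has been fixed, and $Y$ is strong Markov: for every finite stopping time $\tau$, conditionally on $Y(\tau)=(u',v')$, the process $t\mapsto Y(\tau+t)$ is independent of $\mathcal{F}_\tau$ and has the law of the reflected process started at $(u',v')$. $\mathbb{P}_{(u,v)}$ denotes the law when the start is $(u,v)$. The total domination probabilities are $$p_1(u,v)=\mathbb{P}_{(u,v)}\{Y_1(t)\to\infty,\ Y_2(t)/Y_1(t)\to0 \text{ as } t\to\infty\},\qquad p_2(u,v)=\mathbb{P}_{(u,v)}\{Y_2(t)\to\infty,\ Y_1(t)/Y_2(t)\to0\text{ as } t\to\infty\}.$$ *)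

(* Defs.v *)
From HB Require Import structures.
From mathcomp Require Import all_boot all_order all_algebra.
From mathcomp Require Import all_classical all_reals all_analysis.
From mathcomp Require Import measurable_realfun.
Set Implicit Arguments.
Unset Strict Implicit.
Unset Printing Implicit Defensive.
Import Order.TTheory GRing.Theory Num.Theory.
Import numFieldNormedType.Exports.
Local Open Scope classical_set_scope.
Local Open Scope ring_scope.

(* Processes are maps [R -> T -> R * R]; only their values at times [t >= 0]
   are ever used.

   Probabilities of events that are defined by uncountably many times are
   written with the outer measure [mu_ext P].  It equals [P] on measurable sets and
   the completion of [P] on sets that are measurable up to a null set, whereas
   the value of [P] itself on a set that is not measurable is unspecified. *)

Section Paths.
Variable R : realType.

Definition cadlag (V : topologicalType) (x : R -> V) : Prop :=
  (forall t : R, 0 <= t -> x s @[s --> t^'+] --> x t) /\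
  (forall t : R, 0 < t -> exists l : V, x s @[s --> t^'-] --> l).

(* [cumulative R R] bundles monotonicity and right-continuity.  Extending [l]
   by [l 0 = 0] to negative times gives the measure [dl] no atom at 0. *)
Definition regulator (y l : R -> R) : Prop :=
  l 0 = 0 /\
  exists2 lc : cumulative R R, (forall t : R, lc t = l (Num.max 0 t)) &
    (\int[lebesgue_stieltjes_measure lc]_(s in `[0%R, +oo[) (y s)%:E = 0)%E.

Record reflected_path (r1 r2 : R) (z : R * R) (x y l : R -> R * R) : Prop := {
  reflected_ge0 : forall t : R, 0 <= t -> 0 <= (y t).1 /\ 0 <= (y t).2 ;
  reflected_eq1 : forall t : R, 0 <= t ->
    (y t).1 = z.1 + (x t).1 + (l t).1 + r2 * (l t).2 ;
  reflected_eq2 : forall t : R, 0 <= t ->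
    (y t).2 = z.2 + (x t).2 + r1 * (l t).1 + (l t).2 ;
  reflected_reg1 : regulator (fun t => (y t).1) (fun t => (l t).1) ;
  reflected_reg2 : regulator (fun t => (y t).2) (fun t => (l t).2)
}.

Definition dominates1 (y : R -> R * R) : Prop :=
  (y t).1 @[t --> +oo] --> +oo /\ (y t).2 / (y t).1 @[t --> +oo] --> 0.

Definition dominates2 (y : R -> R * R) : Prop :=
  (y t).2 @[t --> +oo] --> +oo /\ (y t).1 / (y t).2 @[t --> +oo] --> 0.

Definition path_measurable : set (set (R -> R * R)) :=
  <<s [set D | exists (t : R) (B : set (R * R)),
         [/\ 0 <= t, measurable B & D = [set y | B (y t)]]] >>.

End Paths.

Section Processes.
Context (d : measure_display) (T : measurableType d) (R : realType).
Variable P : probability T R.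

Record filtration (F : R -> set (set T)) : Prop := {
  filtration_sigma : forall t : R, 0 <= t -> sigma_algebra setT (F t) ;
  filtration_sub : forall t : R, 0 <= t -> F t `<=` measurable ;
  filtration_mono : forall s t : R, 0 <= s -> s <= t -> F s `<=` F t
}.

Definition adapted (F : R -> set (set T)) (X : R -> T -> R * R) : Prop :=
  forall t : R, 0 <= t ->
    forall B : set (R * R), measurable B -> F t (X t @^-1` B).

Record levy_process (X : R -> T -> R * R) : Prop := {
  levy_measurable : forall t : R, 0 <= t -> measurable_fun setT (X t) ;
  levy_0 : {ae P, forall w, X 0 w = 0} ;
  levy_independent : forall (n : nat) (t : nat -> R),
    0 <= t 0%N -> (forall k, t k <= t k.+1) ->
    forall B : 'I_n -> set (R * R), (forall k, measurable (B k)) ->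
    (P [set w | forall k : 'I_n, B k (X (t k.+1) w - X (t k) w)%R] =
     \prod_(k < n) P [set w | B k (X (t k.+1) w - X (t k) w)%R])%E ;
  levy_stationary : forall s h : R, 0 <= s -> 0 <= h ->
    forall B : set (R * R), measurable B ->
    P [set w | B (X (s + h) w - X s w)] = P [set w | B (X h w)] ;
  levy_cadlag : {ae P, forall w, cadlag (X ^~ w)}
}.

Definition stopping_time (F : R -> set (set T)) (tau : T -> R) : Prop :=
  (forall w, 0 <= tau w) /\
  (forall t : R, 0 <= t -> F t [set w | tau w <= t]).

Definition stopped_sigma (F : R -> set (set T)) (tau : T -> R) : set (set T) :=
  [set A | measurable A /\
    forall t : R, 0 <= t -> F t (A `&` [set w | tau w <= t])].

Definition quadrant : set (R * R) := [set z | 0 <= z.1 /\ 0 <= z.2].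

(* In the next two definitions [Y z] is the process started at [z]. *)
Definition path_law (Y : R * R -> R -> T -> R * R) (z : R * R)
    (D : set (R -> R * R)) : \bar R :=
  P [set w | D (fun t => Y z t w)].

(* [w |-> path_law Y (Y z (tau w) w) D] is the conditional probability given
   [F_tau] that the path of [Y z] after [tau] is in [D]. *)
Record strong_markov (F : R -> set (set T)) (Y : R * R -> R -> T -> R * R)
    : Prop := {
  markov_kernel : forall D, path_measurable D ->
    measurable_fun quadrant (fun z => path_law Y z D) ;
  markov_property : forall z, quadrant z ->
    forall tau, stopping_time F tau ->
    forall A, stopped_sigma F tau A ->
    forall D, path_measurable D ->
    (mu_ext P (A `&` [set w | D (fun t => Y z (tau w + t)%R w)]) =
     \int[P]_(w in A) path_law Y (Y z (tau w) w) D)%E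
}.

(* For every start [z], [Y z] is the fixed reflected process and [L z] its
   pair of regulators. *)
Record reflected_family (F : R -> set (set T)) (r1 r2 : R)
    (X : R -> T -> R * R) (Y L : R * R -> R -> T -> R * R) : Prop := {
  family_adaptedY : forall z, quadrant z -> adapted F (Y z) ;
  family_adaptedL : forall z, quadrant z -> adapted F (L z) ;
  family_reflected : forall z, quadrant z ->
    {ae P, forall w, reflected_path r1 r2 z (X ^~ w) (Y z ^~ w) (L z ^~ w)} ;
  family_markov : strong_markov F Y
}.

Definition up_at_infimum (Xi Xj : R -> T -> R) : set T :=
  [set w | exists t : R, [/\ 0 < t, 0 < Xi t w &
                         Xj t w = inf [set Xj s w | s in `[0, t]]]].

Definition domination1 (Y : R * R -> R -> T -> R * R) (u v : R) : \bar R :=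
  (mu_ext P [set w | dominates1 (Y (u, v) ^~ w)])%E.

Definition domination2 (Y : R * R -> R -> T -> R * R) (u v : R) : \bar R :=
  (mu_ext P [set w | dominates2 (Y (u, v) ^~ w)])%E.

End Processes.

(* Main.v *)
(* Pathwise, if every |X_k(t) - mu_k t| is at most C + e t and the start satisfies
   z_i >= const + rho_i z_j, then the pushing of coordinate i by the regulator L_j
   outweighs its own negative drift; coordinate i never reaches 0 and dominates.
   With the law of large numbers this gives p_i -> 1 far out.  From any start,
   iterating the event of (A3) raises coordinate i by fixed amounts while
   coordinate j rises much less, so p_i is bounded below uniformly over j-coordinates
   in a bounded set.  If neither coordinate came close to 0 after some time, the
   regulators would be constant and Y would follow X to -oo; hence Y keeps
   visiting points where one coordinate is below 1, at each of which some
   coordinate dominates with probability at least p > 0, and a zero-one argument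
   yields p_1 + p_2 = 1.

   The law of large numbers for X comes from a maximal inequality: for a random
   walk with negative drift, comparing the means of max(0, xi_0 + M_n) and M_n shows
   that the maximum M_n stays tight; the zero-one argument makes it bounded, and
   Ottaviani's inequality passes from integer to dyadic times. *)

Require Import Defs.
From HB Require Import structures.
From mathcomp Require Import all_boot all_order all_algebra.
From mathcomp Require Import all_classical all_reals all_analysis.
From mathcomp Require Import measurable_realfun.
From mathcomp Require Import ring lra.
Set Implicit Arguments.
Unset Strict Implicit.
Unset Printing Implicit Defensive.
Import Order.TTheory GRing.Theory Num.Theory.
Import numFieldNormedType.Exports.
Local Open Scope classical_set_scope.
Local Open Scope ring_scope.

(** * Regulators *)

(** Solutions of the reflection equations need not be unique, so paths from different starts cannot
    be compared with each other. Every bound that is uniform in the start comes from an event about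
    [X] alone (a bounded deviation from the mean line, or a rise as in (A3)), on which the estimate
    holds for any solution from any suitable start. Events are read at dyadic times and extended to
    all times by right-continuity. The first visit to a set is decomposed over a dyadic grid, so
    that the Markov property is applied at constant times. Two lemmas serve twice. [first_hit] gives
    Ottaviani's inequality for the Levy process and the restart of [Y] at its visits near the axes.
    [zero_one] gives the boundedness of the random walk and total domination; it expresses a
    conditional probability of at least [p] given [G n] by inequalities over the events of [G n]. *)

Section integral_lower_bound.
Context d (T : measurableType d) (R : realType).
Import HBNNSimple.

(** The integral of a nonnegative function is a supremum over simple functions below it, and [c]
    times the indicator of [A] is one of them. So only bounds are asked of [f], which may be a path
    integrated against its regulator or [path_law] along a process. *)
Lemma integral_ge_measure (mu : {measure set T -> \bar R}) (D A : set T)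
    (f : T -> \bar R) (c : R) :
  measurable A -> A `<=` D -> 0 <= c ->
  (forall x, D x -> 0 <= f x)%E -> (forall x, A x -> c%:E <= f x)%E ->
  (c%:E * mu A <= \int[mu]_(x in D) f x)%E.
Proof.
move=> mA AD c0 f0 cf; rewrite ge0_integralE//.
apply: ereal_sup_ubound; exists (scale_nnsfun (indic_nnsfun R mA) c0) => /=.
  move=> x; rewrite /= mindicE /patch.
  have [xA|xA] := boolP (x \in A).
    by rewrite mulr1 mem_set; [exact/cf/set_mem|exact/AD/set_mem].
  by rewrite mulr0; case: ifPn => // /set_mem; exact: f0.
by rewrite (sintegralrM mu c (indic_nnsfun R mA)) sintegral_indic.
Qed.

End integral_lower_bound.

Section regulators.
Variable R : realType.

Lemma regulator_nd (y l : R -> R) (s t : R) :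
  regulator y l -> 0 <= s -> s <= t -> l s <= l t.
Proof.
move=> [_ [lc lcE _]] s0 st.
by have := cumulative_is_nondecreasing lc s t st;
   rewrite !lcE !max_r// (le_trans s0 st).
Qed.

Lemma regulator_ge0 (y l : R -> R) (t : R) : regulator y l -> 0 <= t -> 0 <= l t.
Proof. by move=> yl t0; case: (yl) => <- _; exact: regulator_nd yl _ t0. Qed.

Lemma regulator_right_cvg (y l : R -> R) (t : R) :
  regulator y l -> 0 <= t -> l s @[s --> t^'+] --> l t.
Proof.
move=> [_ [lc lcE _]] t0.
have := @cumulative_is_right_continuous _ _ _ lc t; rewrite lcE max_r//.
apply: cvg_trans; apply: near_eq_cvg; near=> s.
by rewrite lcE max_r// (le_trans t0)//.
Unshelve. all: by end_near. Qed.

(* With [M < c < l t], the measure [dl] of the closed interval on which [l >= c] is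
   at least [l t - c], although [y] is bounded away from 0 there. *)
Lemma regulator_le (y l : R -> R) (M t : R) :
  regulator y l -> (forall s : R, 0 <= s -> 0 <= y s) -> 0 <= t -> 0 <= M ->
  (forall c : R, M < c -> exists2 e : R, 0 < e &
     forall s : R, 0 <= s <= t -> c <= l s -> e <= y s) ->
  l t <= M.
Proof.
move=> yl y0 t0 M0 H; rewrite leNgt; apply/negP => Mlt.
pose c := (M + l t) / 2.
have Mc : M < c by rewrite /c; lra.
have clt : c < l t by rewrite /c; lra.
have [e e0 He] := H c Mc.
pose A := [set s : R | 0 <= s <= t /\ c <= l s].
have At : A t by split; [rewrite t0 lexx|exact: ltW].
have A0 : lbound A 0 by move=> s [/andP[]].
have hA : has_inf A by split; [exists t|exists 0].
pose sg := inf A.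
have sg0 : 0 <= sg by apply: lb_le_inf => //; exists t.
have sgt : sg <= t by apply: ge_inf => //; case: hA.
have lA s : sg < s -> s <= t -> c <= l s.
  move=> sgs st; have [u [/andP[u0 ut] cu] us] := inf_lt hA.1 sgs.
  by rewrite (le_trans cu)//; exact: regulator_nd yl u0 (ltW us).
have lsg : c <= l sg.
  have [->|sgt'] := eqVneq sg t; first exact: ltW.
  have {sgt'} sglt : sg < t by rewrite lt_neqAle sgt'.
  have lcv := regulator_right_cvg yl sg0.
  rewrite -(cvg_lim _ lcv)//.
  apply: limr_ge; first by apply/cvg_ex; exists (l sg).
  near=> s; apply: lA; first by near: s; exact: nbhs_right_gt.
  by near: s; exact: nbhs_right_le.
case: (yl) => l0 [lc lcE int0].
pose mu : {measure set (measurableTypeR R) -> \bar R} := lebesgue_stieltjes_measure lc.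
have muoc (a b : R) : a <= b -> mu `]a, b]%classic = (lc b - lc a)%:E.
  move=> ab; rewrite /mu /= /lebesgue_stieltjes_measure /measure_extension.
  rewrite measurable_mu_extE/=; last exact: is_ocitv.
  by rewrite wlength_itv_bnd.
have musgt : (mu `[sg, t]%classic <= 0)%E.
  have : (e%:E * mu `[sg, t]%classic <= 0)%E.
    rewrite -int0; apply: integral_ge_measure => //.
    + by move=> s /=; rewrite !in_itv/= andbT => /andP[/(le_trans sg0)].
    + exact: ltW.
    + by move=> s /=; rewrite in_itv/= andbT lee_fin; exact: y0.
    + move=> s /=; rewrite in_itv/= lee_fin => /andP[sgs st].
      apply: He; first by rewrite (le_trans sg0)//.
      by rewrite (le_trans lsg)//; exact: regulator_nd yl _ _.
  by rewrite pmule_rle0// lte_fin.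
(* Before [sg] the regulator is below [c]. Half-open intervals exhaust the open one from inside, so
   no left limit of [l] enters. The left end -1 is a negative time, where [lc] equals [l 0 = 0]. *)
have mulo : (mu `](-1)%R, sg[%classic <= c%:E)%E.
  have -> : `]-1, sg[%classic = \bigcup_n `]-1, sg - n.+1%:R^-1]%classic.
    exact: itv_bnd_open_bigcup.
  have := @nondecreasing_cvg_mu _ _ _ mu (fun n => `]-1, sg - n.+1%:R^-1]%classic).
  move=> /(_ (fun=> measurable_itv _) (bigcupT_measurable _ (fun=> measurable_itv _))) H1.
  rewrite -(cvg_lim _ (H1 _))//; last first.
    move=> n m nm; apply/subsetPset => x /=; rewrite !in_itv/= => /andP[->/=].
    move=> /le_trans; apply; rewrite lerD2l lerN2 lef_pV2 ?posrE ?ltr0n//.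
    by rewrite ler_nat ltnS.
  apply: lime_le.
    apply/cvg_ex; eexists; apply: H1 => n m nm.
    apply/subsetPset => x /=; rewrite !in_itv/= => /andP[->/=].
    move=> /le_trans; apply; rewrite lerD2l lerN2 lef_pV2 ?posrE ?ltr0n//.
    by rewrite ler_nat ltnS.
  near=> n => /=; have n0 : 0 < n.+1%:R^-1 :> R by rewrite invr_gt0.
  have n1 : n.+1%:R^-1 <= 1 :> R by rewrite invf_le1 ?ler1n.
  set q := n.+1%:R^-1 in n0 n1 *.
  rewrite muoc; last by move: (q) n0 n1 => q' ? ?; lra.
  rewrite lee_fin.
  rewrite !lcE (@max_l _ _ 0 (-1)) ?l0 ?subr0; last lra.
  have [hn|hn] := leP 0 (sg - q); last by rewrite l0; lra.
  rewrite leNgt; apply/negP => cl.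
  have : A (sg - q).
    split; last exact: ltW.
    by rewrite hn/=; move: sgt; lra.
  by case: hA => _ bA /(ge_inf bA); rewrite -/sg; lra.
have : (mu `](-1)%R, t]%classic <= c%:E)%E.
  rewrite -(adde0 c%:E); apply: le_trans (leeD mulo musgt).
  apply: le_trans (measureU2 _ _ _) => //.
  apply: le_measure; rewrite ?inE//; first exact: measurableU.
  move=> x /=; rewrite !in_itv/= => /andP[-> ->]/=; rewrite andbT.
  by case: (ltP x sg) => ?; [left|right].
rewrite muoc; last by move: t0; lra.
rewrite !lcE max_r// (@max_l _ _ 0 (-1)) ?l0 ?lee_fin; last lra.
by lra.
Unshelve. all: by end_near. Qed.

End regulators.

(** * Dyadic times *)

Section dyadic_times.
Variable R : realType.

Definition dy (m l : nat) : R := l%:R / 2 ^+ m.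

Lemma dy_ge0 m l : 0 <= dy m l.
Proof. by rewrite divr_ge0// exprn_ge0. Qed.

Lemma dy0 n : dy 0 n = n%:R.
Proof. by rewrite /dy expr0 divr1. Qed.

Lemma dyE m k l : dy (m + k) (l * 2 ^ k) = dy m l.
Proof.
rewrite /dy natrM natrX exprD invfM mulrACA -mulrA divff ?mulr1 ?expf_neq0//.
Qed.

Lemma dyD m l k : dy m l + dy m k = dy m (l + k).
Proof. by rewrite /dy -mulrDl natrD. Qed.

Lemma dy_common m l m' l' :
  dy m l = dy (m + m') (l * 2 ^ m') /\ dy m' l' = dy (m + m') (l' * 2 ^ m).
Proof. by rewrite dyE addnC dyE. Qed.

Lemma ler_dy m l k : (dy m l <= dy m k) = (l <= k)%N.
Proof. by rewrite /dy ler_pM2r ?invr_gt0 ?exprn_gt0// ler_nat. Qed.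

Lemma dyadicB m l m' l' : dy m' l' <= dy m l ->
  exists k q, dy m l = dy m' l' + dy k q.
Proof.
have [-> ->] := dy_common m l m' l'; rewrite ler_dy => le.
exists (m + m')%N, (l * 2 ^ m' - l' * 2 ^ m)%N.
by rewrite dyD subnKC.
Qed.

Lemma dyadic_between (s t : R) : 0 <= s -> s < t ->
  exists m l, s < dy m l < t.
Proof.
move=> s0 st.
pose m := Num.truncn (t - s)^-1.
have q0 : (0 : R) < 2 ^+ m by rewrite exprn_gt0.
have hm : (2 ^+ m)^-1 < t - s.
  rewrite -[X in _ < X]invrK ltf_pV2 ?posrE ?invr_gt0 ?subr_gt0//.
  apply: (lt_le_trans (truncnS_gt _)); rewrite -/m -natrX ler_nat.
  exact: ltn_expl.
exists m, (Num.truncn (s * 2 ^+ m)).+1; rewrite /dy ltr_pdivlMr// truncnS_gt/=.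
rewrite ltr_pdivrMr// -natr1.
have h1 : (Num.truncn (s * 2 ^+ m))%:R <= s * 2 ^+ m by rewrite truncn_le mulr_ge0// exprn_ge0.
have h2 : 1 < (t - s) * 2 ^+ m by rewrite -ltr_pdivrMr// mul1r.
by move: h1 h2; rewrite mulrBl; lra.
Qed.

(** Bounds proved at countably many times become bounds at all times through this lemma:
    right-continuity carries a weak inequality from the dyadic times shortly after [t] to [t]. *)
Lemma right_cvg_ge_dyadic (f : R -> R) (c t u : R) : 0 <= t -> t < u ->
  f s @[s --> t^'+] --> f t ->
  (forall m l, t < dy m l < u -> c <= f (dy m l)) -> c <= f t.
Proof.
move=> t0 tu cf H; rewrite leNgt; apply/negP => ft.
have : \forall s \near t^'+, f s < c by exact: (cvgr_lt _ cf).
move=> [e /= e0 He].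
have [|m [l /andP[tm me]]] := @dyadic_between t (Num.min u (t + e)) t0.
  by rewrite lt_min tu ltrDl.
move: me; rewrite lt_min => /andP[mu me].
have := H m l; rewrite tm mu => /(_ isT); apply/negP; rewrite -ltNge; apply: He => //=.
by rewrite ltr0_norm ?subr_lt0// opprB; lra.
Qed.

End dyadic_times.
Arguments dy {R}.

Section cadlag_paths.
Variable R : realType.

(** One-sided limits bound the path near each point, and compactness of the segment makes the bound
    uniform. At 0 the guard [0 <= u] discards the negative times, where the path is arbitrary. *)
Lemma cadlag_bounded (x : R -> R) (t : R) : cadlag x -> 0 <= t ->
  exists C : nat, forall s, 0 <= s <= t -> `|x s| <= C%:R.
Proof.
move=> [rx lx] t0.
have /compact_near_coveringP/(_ nat \oo (fun n s => 0 <= s -> `|x s| <= n%:R)) :=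
  @segment_compact R 0 t.
move=> /(_ _) [].
  move=> s /=; rewrite in_itv/= => /andP[s0 st].
  have [C1 HC1] : exists C : R, \forall u \near s^'+, `|x u| <= C.
    exists (`|x s| + 1).
    have : \forall u \near s^'+, `|x u| < `|x s| + 1.
      by apply: (cvgr_lt `|x s|); [apply: cvg_norm; exact: rx|rewrite ltrDl].
    by apply: filterS => u /ltW.
  have [C2 HC2] : exists C : R, \forall u \near s^'-, 0 <= u -> `|x u| <= C.
    have [<-|s0'] := eqVneq 0 s.
      exists 0; near=> u => u0.
      have : u < 0 by near: u; exact: nbhs_left_lt.
      by rewrite ltNge u0.
    have [|l xl] := lx s; first by rewrite lt_neqAle s0'.
    exists (`|l| + 1).
    have : \forall u \near s^'-, `|x u| < `|l| + 1.
      by apply: (cvgr_lt `|l|); [apply: cvg_norm; exact: xl|rewrite ltrDl].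
    by apply: filterS => u /ltW.
  have [C HC] : exists C : R, \forall u \near s, 0 <= u -> `|x u| <= C.
    exists (Num.max `|x s| (Num.max C1 C2)).
    move: HC1 HC2; rewrite /at_right /at_left /within/= => HC1 HC2.
    near=> u => u0; rewrite !le_max.
    have [us|us|->] := ltgtP u s; last by rewrite lexx.
    + have -> : `|x u| <= C2 by move: us u0; near: u.
      by rewrite !orbT.
    + have -> : `|x u| <= C1 by move: us; near: u.
      by rewrite !orbT.
  exists ([set u | 0 <= u -> `|x u| <= C], [set n : nat | C <= n%:R]) => /=.
    split; first exact: HC.
    exists (Num.truncn C).+1 => // n /= hn.
    by rewrite (le_trans (ltW (truncnS_gt _)))// ler_nat.
  by move=> [u n] /= [h1 h2] u0; exact: le_trans (h1 u0) h2.
move=> N _ HN; exists N => s /andP[s0 st].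
by apply: (HN N) => //=; rewrite in_itv/= s0.
Unshelve. all: by end_near. Qed.

End cadlag_paths.

(** * Domination along reflected paths *)

Section domination_paths.
Variable R : realType.
Implicit Types (x y l : R -> R * R) (z mu : R * R) (i : bool).

(* [axis true] is the first coordinate, and [~~ i] is the coordinate other than [i]. *)
Definition axis (i : bool) (z : R * R) : R := if i then z.1 else z.2.

Definition dominates (i : bool) (y : R -> R * R) : Prop :=
  axis i (y t) @[t --> +oo] --> +oo /\
  axis (~~ i) (y t) / axis i (y t) @[t --> +oo] --> 0.

(* Countably many times make this version of [dominates] a path-measurable event. *)
Definition dyadic_dominates (i : bool) (y : R -> R * R) : Prop :=
  forall n : nat, exists N : nat, forall m k, (N%:R : R) <= dy m k ->
    n%:R <= axis i (y (dy m k)) /\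
    n%:R * axis (~~ i) (y (dy m k)) <= axis i (y (dy m k)).

Definition nonneg_path y := forall t i, 0 <= t -> 0 <= axis i (y t).

Definition right_continuous_path y :=
  forall t i, 0 <= t -> axis i (y s) @[s --> t^'+] --> axis i (y t).

Lemma right_continuous_coord x i t : cadlag x -> 0 <= t ->
  axis i (x s) @[s --> t^'+] --> axis i (x t).
Proof.
move=> [rx _] t0; case: i.
  by apply: (cvg_comp _ _ (rx t t0)); exact: cvg_fst.
by apply: (cvg_comp _ _ (rx t t0)); exact: cvg_snd.
Qed.

Lemma cadlag_coord x i : cadlag x -> cadlag (fun t => axis i (x t)).
Proof.
move=> cx; split=> t t0; first exact: right_continuous_coord.
have [_ /(_ t t0) [lim xl]] := cx.
exists (axis i lim); case: i.
  by apply: (cvg_comp _ _ xl); exact: cvg_fst.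
by apply: (cvg_comp _ _ xl); exact: cvg_snd.
Qed.

(** Multiplying the quotient out gives weak inequalities, the kind that right-continuity extends to
    all times; for [n > 0] the bound [n] on coordinate [i] keeps the denominator positive. *)
Lemma dominatesE i y : nonneg_path y -> right_continuous_path y ->
  dominates i y <-> dyadic_dominates i y.
Proof.
move=> y0 ry; split.
  move=> [/cvgryPge Hy /cvgrPdist_le Hr] n.
  have := Hr n.+1%:R^-1; rewrite invr_gt0 ltr0n => /(_ isT).
  have := Hy n.+1%:R.
  move=> [A [Ar HA]] [B [Br HB]].
  exists (Num.truncn (Num.max A B)).+1 => m k mk.
  have : Num.max A B < dy m k.
    by apply: lt_le_trans mk; exact: truncnS_gt.
  rewrite gt_max => /andP[Am Bm].
  have := HA _ Am; have := HB _ Bm.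
  rewrite sub0r normrN => h1 h2.
  have yi : 0 < axis i (y (dy m k)) by apply: lt_le_trans h2; rewrite ltr0n.
  have yj := y0 (dy m k) (~~ i) (dy_ge0 _ _ _).
  split; first by rewrite (le_trans _ h2)// ler_nat.
  move: h1; rewrite ger0_norm ?(divr_ge0 yj (ltW yi))// ler_pdivrMr// => h1.
  have n0 : (0 : R) < n.+1%:R by rewrite ltr0n.
  have : n.+1%:R * axis (~~ i) (y (dy m k)) <= axis i (y (dy m k)).
    by rewrite -ler_pdivlMl.
  by apply: le_trans; rewrite ler_wpM2r// ler_nat.
move=> H.
have {}H : forall n : nat, exists N : nat, forall t : R, N%:R <= t ->
    n%:R <= axis i (y t) /\ n%:R * axis (~~ i) (y t) <= axis i (y t).
  move=> n; have [N HN] := H n; exists N => t Nt.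
  have t0 : 0 <= t by apply: le_trans Nt.
  have tt : t < t + 1 by rewrite ltrDl.
  split.
    apply: (right_cvg_ge_dyadic t0 tt (ry t i t0)) => m k /andP[tm _].
    by have [] := HN m k (le_trans Nt (ltW tm)).
  rewrite -subr_ge0.
  pose f t := axis i (y t) - n%:R * axis (~~ i) (y t).
  apply: (@right_cvg_ge_dyadic _ f 0 t _ t0 tt).
    by apply: cvgB; [exact: ry|apply: cvgMr; exact: ry].
  move=> m k /andP[tm _]; rewrite subr_ge0.
  by have [] := HN m k (le_trans Nt (ltW tm)).
split.
  apply/cvgryPge => A; have [N HN] := H (Num.truncn A).+1.
  exists N%:R; split; first exact: num_real.
  move=> t /ltW /HN [h _]; apply: le_trans h; apply: ltW.
  exact: truncnS_gt.
apply/cvgrPdist_le => e e0; have [N HN] := H (Num.truncn e^-1).+1.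
exists N%:R; split; first exact: num_real.
move=> t Nt; have [h1 h2] := HN _ (ltW Nt).
have yi : 0 < axis i (y t) by apply: lt_le_trans h1; rewrite ltr0n.
have t0 : 0 <= t by apply: le_trans (ltW Nt).
rewrite sub0r normrN ger0_norm ?divr_ge0 ?y0// ler_pdivrMr//.
rewrite -ler_pdivrMl//; apply: le_trans h2.
by rewrite ler_wpM2r ?y0// ltW// truncnS_gt.
Qed.

(** Differences of dyadic times are dyadic, so late dyadic times remain such when counted from
    [dy m k]. This is the direction that a restart of the path calls for. *)
Lemma dyadic_dominates_shift i y m k :
  dyadic_dominates i (fun t => y (dy m k + t)) -> dyadic_dominates i y.
Proof.
move=> H n; have [N HN] := H n.
exists (N + (Num.truncn (dy m k : R)).+1)%N => m' k' h.
have hk := truncnS_gt (dy m k : R).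
have [|a [b ab]] := @dyadicB R m' k' m k.
  apply: (le_trans (ltW hk)); apply: le_trans h.
  by rewrite ler_nat leq_addl.
rewrite ab; apply: HN; move: h; rewrite ab natrD; lra.
Qed.

Lemma dominates_disjoint i y :
  nonneg_path y -> dyadic_dominates i y -> dyadic_dominates (~~ i) y -> False.
Proof.
move=> y0 /(_ 2%N)[N HN] /(_ 2%N)[N' HN'].
have h0 := HN 0%N (maxn N N'); have h1 := HN' 0%N (maxn N N').
move: h0 h1; rewrite !dy0 !ler_nat leq_maxl leq_maxr negbK.
move=> /(_ isT)[h1 h2] /(_ isT)[h3 h4].
lra.
Qed.

End domination_paths.

Section reflected_paths.
Variables (R : realType) (r1 r2 : R).
Hypotheses (r1_gt0 : 0 < r1) (r2_gt0 : 0 < r2).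
Implicit Types (x y l : R -> R * R) (z mu : R * R) (i : bool) (s t : R).

(* The rate at which coordinate [i] is pushed by the regulator of the other one. *)
Definition rho (i : bool) : R := if i then r2 else r1.

Lemma rho_gt0 i : 0 < rho i. Proof. by case: i. Qed.

Lemma reflected_coord z x y l i t : reflected_path r1 r2 z x y l -> 0 <= t ->
  axis i (y t) = axis i z + axis i (x t) + axis i (l t)
                  + rho i * axis (~~ i) (l t).
Proof.
move=> h t0; case: i; rewrite /= ?(reflected_eq1 h t0) ?(reflected_eq2 h t0)//.
by rewrite addrAC.
Qed.

Lemma reflected_nonneg z x y l : reflected_path r1 r2 z x y l -> nonneg_path y.
Proof. by move=> h t [] t0; have [] := reflected_ge0 h t0. Qed.

Lemma reflected_regulator z x y l i : reflected_path r1 r2 z x y l ->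
  regulator (fun t => axis i (y t)) (fun t => axis i (l t)).
Proof. by case: i => -[]. Qed.

Lemma reflected_right_continuous z x y l : reflected_path r1 r2 z x y l ->
  cadlag x -> right_continuous_path y.
Proof.
move=> h cx t i t0; rewrite (reflected_coord i h t0).
have : axis i z + axis i (x s) + axis i (l s) + rho i * axis (~~ i) (l s)
    @[s --> t^'+] --> axis i z + axis i (x t) + axis i (l t)
    + rho i * axis (~~ i) (l t).
  apply: cvgD.
    apply: cvgD; first by apply: cvgD; [exact: cvg_cst|exact: right_continuous_coord].
    exact: regulator_right_cvg (reflected_regulator i h) t0.
  apply: cvgMr; exact: regulator_right_cvg (reflected_regulator (~~ i) h) t0.
apply: cvg_trans; apply: near_eq_cvg; near=> s.
by rewrite (reflected_coord i h)// (le_trans t0).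
Unshelve. all: by end_near. Qed.

Lemma regulator_coord_ge0 z x y l i t : reflected_path r1 r2 z x y l ->
  0 <= t -> 0 <= axis i (l t).
Proof. by move=> h t0; exact: regulator_ge0 (reflected_regulator i h) t0. Qed.

(* Pushing by the other regulator can only decrease the need for pushing. *)
Lemma regulator_coord_le z x y l i t M : reflected_path r1 r2 z x y l ->
  0 <= t -> 0 <= M ->
  (forall s, 0 <= s <= t -> - M <= axis i z + axis i (x s)) ->
  axis i (l t) <= M.
Proof.
move=> h t0 M0 H; apply: (regulator_le (reflected_regulator i h)) => //.
  by move=> s; exact: (reflected_nonneg h).
move=> c Mc; exists (c - M); first by rewrite subr_gt0.
move=> s /[dup] hs /andP[s0 _] cl; rewrite (reflected_coord i h s0).
have := mulr_ge0 (ltW (rho_gt0 i)) (regulator_coord_ge0 (~~ i) h s0).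
have := H s hs; lra.
Qed.

(** That some [C] exists for every [e > 0] is the law of large numbers [f t / t --> m], in a form
    that is usable from time 0 on. *)
Definition near_line (C e m : R) (f : R -> R) : Prop :=
  forall t : R, 0 <= t -> `|f t - m * t| <= e * t + C.

Lemma near_lineP C e m f t : near_line C e m f -> 0 <= t ->
  m * t - e * t - C <= f t <= m * t + e * t + C.
Proof. by move=> h t0; have := h t t0; rewrite ler_norml; lra. Qed.

(** * Recurrence and escape along a single path *)

Section escape.
Variables (z mu : R * R) (x y l : R -> R * R) (i : bool).
Hypothesis xyl : reflected_path r1 r2 z x y l.
Hypothesis z0 : forall k, 0 <= axis k z.
Hypothesis mu0 : forall k, axis k mu < 0.

Lemma reflected_recurs (N : R) : 0 <= N -> cadlag x ->
  (forall k, exists C, near_line C (- axis k mu / 2) (axis k mu)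
                        (fun t => axis k (x t))) ->
  exists m q k, N <= dy m q /\ axis k (y (dy m q)) < 1.
Proof.
move=> N0 cx xC; apply: contrapT => H.
have {}H k t : N <= t -> 1 <= axis k (y t).
  move=> Nt; have t0 := le_trans N0 Nt.
  have tt : t < t + 1 by rewrite ltrDl.
  have ry := reflected_right_continuous xyl cx.
  apply: (right_cvg_ge_dyadic t0 tt (ry t k t0)).
  move=> m q /andP[tm _]; rewrite leNgt; apply/negP => h; apply: H.
  by exists m, q, k; split => //; rewrite (le_trans Nt)// ltW.
(* A regulator can exceed its value at [N] only after [N], where the coordinate is at least 1, so
   [regulator_le] applies with that value as the bound. *)
have lN k t : N <= t -> axis k (l t) <= axis k (l N).
  move=> Nt; apply: (regulator_le (reflected_regulator k xyl)).
  - by move=> s; exact: (reflected_nonneg xyl).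
  - exact: le_trans Nt.
  - exact: regulator_coord_ge0 xyl N0.
  - move=> c Nc; exists 1 => // s /andP[s0 st] cl; apply: H.
    rewrite leNgt; apply/negP => sN.
    have := regulator_nd (reflected_regulator k xyl) s0 (ltW sN); lra.
have [C HC] := xC true.
pose m1 := axis true mu; have m1_lt0 : m1 < 0 := mu0 true.
pose K := axis true z + C + axis true (l N) + rho true * axis false (l N).
(* By this time half of the drift has used up the constants collected in [K], which contradicts the
   lower bound 1. *)
pose t := N + `|K| / (- m1 / 2).
have tN : N <= t by rewrite lerDl divr_ge0//; lra.
have t0 := le_trans N0 tN.
have := H true t tN; rewrite (reflected_coord true xyl t0)/=.
have /andP[_] := near_lineP HC t0.
have h1 : rho true * (l t).2 <= rho true * axis false (l N).
  by rewrite ler_pM2l ?rho_gt0//; exact: (lN false).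
have h2 := lN true t tN.
have h3 : t * (- m1 / 2) = N * (- m1 / 2) + `|K|.
  by rewrite /t mulrDl divfK//; lra.
have h4 : 0 <= N * (- m1 / 2) by rewrite mulr_ge0//; lra.
have := ler_norm K; rewrite {1}/K /=.
move: h1 h2; rewrite /= -/m1 => h1 h2.
have : m1 * t + - m1 / 2 * t = - (t * (- m1 / 2)) by lra.
lra.
Qed.

Variables (C e : R).
Hypothesis e0 : 0 < e.
Hypothesis drift : 0 < axis i mu - e + rho i * (- axis (~~ i) mu - e).
Hypothesis xC : forall k, near_line C e (axis k mu) (fun t => axis k (x t)).
Hypothesis far : C * (1 + rho i) + 1 + rho i * axis (~~ i) z <= axis i z.

Let D := axis i mu - e + rho i * (- axis (~~ i) mu - e).

(** Write [j] for [~~ i]. As long as the regulator of [i] vanishes, nonnegativity of coordinate [j]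
    at time [s] forces the regulator of [j] up to at least [(|mu_j| - e) s - C - z_j]; times
    [rho i], this outgrows the fall of coordinate [i] at rate [D]. Between [s] and [t] only
    monotonicity is used, hence the negative term. The constants in [far] absorb the errors [C] of
    both coordinates of [x] and leave the margin 1. *)
Let lower_bound (s t : R) : 0 <= s -> s <= t -> axis i (l s) = 0 ->
  1 + D * s + (axis i mu - e) * (t - s) <= axis i z + axis i (x t) + rho i * axis (~~ i) (l t).
Proof.
move=> s0 st ls0.
have t0 := le_trans s0 st.
have h1 := regulator_nd (reflected_regulator (~~ i) xyl) s0 st.
have := reflected_nonneg xyl (~~ i) s0.
rewrite (reflected_coord _ xyl s0) negbK ls0 mulr0 addr0 => h2.
have /andP[_ h3] := near_lineP (xC (~~ i)) s0.
have /andP[h4 _] := near_lineP (xC i) t0.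
have h5 : - axis (~~ i) z - C + (- axis (~~ i) mu - e) * s <= axis (~~ i) (l t) by lra.
have := ler_wpM2l (ltW (rho_gt0 i)) h5.
move: far h4; rewrite /D; lra.
Qed.

(* If the regulator of [i] vanishes up to time [s], then [lower_bound] keeps
   coordinate [i] away from 0 up to [s + h] with [h] independent of [s]. *)
Lemma escape_regulator t : 0 <= t -> axis i (l t) = 0.
Proof.
move=> t0.
(* Over a time [h] the negative term of [lower_bound] costs at most half of the margin 1, so
   coordinate [i] is at least 1/2 throughout the next step. *)
pose h := 2^-1 / (e - axis i mu).
have mi := mu0 i.
have emi : 0 < e - axis i mu by rewrite subr_gt0 (lt_trans mi).
have h0 : 0 < h by rewrite divr_gt0.
have hh : h * (e - axis i mu) = 2^-1 by rewrite divfK// gt_eqF.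
have l0 s : 0 <= s -> axis i (l s) <= 0 -> axis i (l s) = 0.
  by move=> s0 ls; apply/eqP; rewrite eq_le ls (regulator_coord_ge0 i xyl s0).
have H k : axis i (l (k%:R * h)) = 0.
  elim: k => [|k IH]; first by rewrite mul0r; case: (reflected_regulator i xyl).
  have kh : 0 <= k%:R * h by rewrite mulr_ge0// ltW.
  have kh1 : 0 <= k.+1%:R * h by rewrite mulr_ge0// ltW.
  apply: (l0) => //; apply: (regulator_le (reflected_regulator i xyl)) => //.
    by move=> s; exact: (reflected_nonneg xyl).
  move=> c _; exists 2^-1; first by rewrite invr_gt0.
  move=> s /andP[s0 st] _.
  rewrite (reflected_coord _ xyl s0).
  have ls := regulator_coord_ge0 i xyl s0.
  pose u := Num.min s (k%:R * h).
  have u0 : 0 <= u by rewrite le_min s0.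
  have us : u <= s by rewrite ge_min lexx.
  have uk : u <= k%:R * h by rewrite ge_min lexx orbT.
  have lu : axis i (l u) = 0.
    by apply: (l0) => //; rewrite -IH; exact: regulator_nd (reflected_regulator i xyl) _ _.
  have := lower_bound u0 us lu.
  have Du : 0 <= D * u by rewrite mulr_ge0// ltW.
  have su : s - u <= h.
    rewrite /u; case: (leP s (k%:R * h)) => _; first by rewrite subrr ltW.
    by move: st; rewrite -natr1 mulrDl mul1r; lra.
  have : (s - u) * (e - axis i mu) <= 2^-1.
    by rewrite -hh ler_wpM2r//; lra.
  lra.
apply: (l0) => //; rewrite -(H (Num.truncn (t / h)).+1).
apply: (regulator_nd (reflected_regulator i xyl)) => //.
by rewrite -ler_pdivrMr// ltW// truncnS_gt.
Qed.

(** Once the regulator of [i] is known to be 0, the other coordinate is pushed by its own regulator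
    alone, which [regulator_coord_le] bounds by the depth of [x]. It therefore grows at most at rate
    [2 * e'] for every [e' > 0], while coordinate [i] grows at least at rate [D]. *)
Lemma escape_dominates :
  (forall e', 0 < e' -> exists C', near_line C' e' (axis (~~ i) mu)
     (fun t => axis (~~ i) (x t))) -> dyadic_dominates i y.
Proof.
move=> xe n.
have D0 : 0 < D by [].
(* Then [n] times the rate [2 * e'] is at most [D / 2]; the other half of [D] absorbs the constants
   after the time [A] below. *)
pose e' := D / (4 * n.+1%:R).
have n0 : (0 : R) < n.+1%:R by [].
have e'0 : 0 < e' by rewrite divr_gt0// mulr_gt0.
have ne' : n%:R * e' <= D / 4.
  have e'E : n.+1%:R * e' = D / 4 by rewrite mulrC /e' invfM mulrA divfK// gt_eqF.
  by rewrite -e'E ler_wpM2r ?ler_nat// ltW.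
have [C' HC'] := xe e' e'0.
have C'0 : 0 <= C' by have := HC' 0 (lexx 0); rewrite !mulr0 add0r; apply: le_trans.
pose j := ~~ i.
have yj t : 0 <= t -> axis j (y t) <= axis j z + 2 * C' + 2 * e' * t.
  move=> t0; rewrite (reflected_coord _ xyl t0) /j negbK escape_regulator// mulr0 addr0.
  have mj := mu0 (~~ i).
  have h1 : 0 <= (e' - axis (~~ i) mu) * t by rewrite mulr_ge0//; lra.
  have := @regulator_coord_le _ _ _ _ (~~ i) t (C' + (e' - axis (~~ i) mu) * t) xyl t0.
  have /andP[_ h2] := near_lineP HC' t0.
  have -> : (e' - axis (~~ i) mu) * t = e' * t - axis (~~ i) mu * t by lra.
  move=> h3; suff : axis (~~ i) (l t) <= C' + (e' * t - axis (~~ i) mu * t) by lra.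
  apply: h3; first lra.
  move=> s /andP[s0 st]; have /andP[h4 _] := near_lineP HC' s0.
  have := z0 (~~ i).
  have : (e' - axis (~~ i) mu) * s <= (e' - axis (~~ i) mu) * t.
    by rewrite ler_wpM2l//; lra.
  lra.
have yi t : 0 <= t -> 1 + D * t <= axis i (y t).
  move=> t0; have := lower_bound t0 (lexx t) (escape_regulator t0).
  rewrite (reflected_coord _ xyl t0) escape_regulator//; lra.
pose A := (n%:R + 2 * n%:R * (axis j z + 2 * C')) / D.
exists (Num.truncn A).+1 => m k mk.
set t := dy m k in mk *.
have t0 : 0 <= t by exact: dy_ge0.
have At : A <= t by apply: le_trans mk; rewrite ltW// truncnS_gt.
move: At; rewrite /A ler_pdivrMr// => At.
have zj : 0 <= n%:R * (axis j z + 2 * C').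
  by rewrite mulr_ge0// addr_ge0 ?z0// mulr_ge0.
have nn : (0 : R) <= n%:R by [].
split; first by have := yi t t0; lra.
have := ler_wpM2l nn (yj t t0).
have := yi t t0.
have := ler_wpM2r t0 ne'.
lra.
Qed.

End escape.

(** At time [s] coordinate [~~ i] of [x] is within [eta] of its running infimum, and its regulator
    never exceeds the depth of that infimum below the start, so together they add at most [eta]. The
    other cost is the push by the regulator of [i], which is at most [D - z_i] and disappears when
    coordinate [i] starts at [D] or above. *)
Lemma reflected_cycle z x y l i (a eta D s : R) :
  reflected_path r1 r2 z x y l -> (forall k, 0 <= axis k z) -> cadlag x ->
  x 0 = 0 -> 0 <= s -> 0 <= eta ->
  a <= axis i (x s) ->
  (forall t, 0 <= t <= s -> axis (~~ i) (x s) <= axis (~~ i) (x t) + eta) ->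
  (forall t, 0 <= t <= s -> - D <= axis i (x t)) ->
  axis i z + a <= axis i (y s) /\
  axis (~~ i) (y s) <= axis (~~ i) z + eta
     + rho (~~ i) * Num.max 0 (D - axis i z).
Proof.
move=> h z0 cx x0 s0 eta0 xi xj xD.
have li := regulator_coord_ge0 i h s0.
have lj := regulator_coord_ge0 (~~ i) h s0.
split.
  rewrite (reflected_coord i h s0).
  have := mulr_ge0 (ltW (rho_gt0 i)) lj; lra.
rewrite (reflected_coord _ h s0) negbK.
have li' : axis i (l s) <= Num.max 0 (D - axis i z).
  apply: (regulator_coord_le h s0); first by rewrite le_max lexx.
  move=> t /xD; have : D - axis i z <= Num.max 0 (D - axis i z).
    by rewrite le_max lexx orbT.
  lra.
have := ler_wpM2l (ltW (rho_gt0 (~~ i))) li'.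
suff : axis (~~ i) (x s) + axis (~~ i) (l s) <= eta by lra.
have x0s : axis (~~ i) (x s) <= eta.
  by have := xj 0; rewrite lexx s0 x0 => /(_ isT); case: (i); rewrite /= add0r.
pose M := Num.max 0 (eta - axis (~~ i) z - axis (~~ i) (x s)).
have : axis (~~ i) (l s) <= M.
  apply: (regulator_coord_le h s0); first by rewrite le_max lexx.
  move=> t /xj.
  have : eta - axis (~~ i) z - axis (~~ i) (x s) <= M.
    by rewrite le_max lexx orbT.
  lra.
have := z0 (~~ i).
by rewrite /M; case: (leP 0 (eta - axis (~~ i) z - axis (~~ i) (x s))); lra.
Qed.

End reflected_paths.

(** * Probability along a discrete filtration *)

Section sigma_algebra_closure.
Context (T : Type) (G : set (set T)).
Hypothesis sG : sigma_algebra setT G.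

Lemma salgC A : G A -> G (~` A).
Proof. by case: sG => _ GC _ /GC; rewrite setTD. Qed.

Lemma salgT : G setT.
Proof. by rewrite -setC0; apply: salgC; case: sG. Qed.

Lemma salg_bigcup (F : (set T)^nat) : (forall n, G (F n)) -> G (\bigcup_n F n).
Proof. by case: sG => _ _; apply. Qed.

Lemma salg_bigcap (F : (set T)^nat) : (forall n, G (F n)) -> G (\bigcap_n F n).
Proof.
move=> GF; rewrite -[X in G X]setCK setC_bigcap; apply: salgC.
by apply: salg_bigcup => n; exact: salgC.
Qed.

Lemma salgU A B : G A -> G B -> G (A `|` B).
Proof.
move=> GA GB; rewrite -bigcup2E; apply: salg_bigcup => -[|[|n]]//=.
by case: sG.
Qed.

Lemma salgI A B : G A -> G B -> G (A `&` B).
Proof.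
move=> GA GB; rewrite -[X in G X]setCK setCI; apply: salgC.
by apply: salgU; exact: salgC.
Qed.

Lemma salg_imp (A : Prop) B : (A -> G B) -> G [set w | A -> B w].
Proof.
have [a|na] := pselect A.
  by move=> /(_ a); congr G; apply/seteqP; split=> w /=; [|move=> /(_ a)].
move=> _; rewrite (_ : [set _ | _] = setT); first exact: salgT.
by apply/seteqP; split=> w //= _ /na.
Qed.

End sigma_algebra_closure.

Section real_probability.
Context d (T : measurableType d) (R : realType) (P : probability T R).

Definition pr (A : set T) : R := fine (P A).

Lemma prE A : measurable A -> P A = (pr A)%:E.
Proof. by move=> mA; rewrite fineK// fin_num_measure. Qed.

Lemma pr_ge0 A : 0 <= pr A. Proof. by rewrite fine_ge0. Qed.

Lemma prT : pr setT = 1. Proof. by rewrite /pr probability_setT. Qed.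

Lemma le_pr A B : measurable A -> measurable B -> A `<=` B -> pr A <= pr B.
Proof. by move=> mA mB AB; rewrite -lee_fin -!prE// le_measure ?inE. Qed.

Lemma pr_le1 A : measurable A -> pr A <= 1.
Proof. by move=> mA; rewrite -prT le_pr. Qed.

Lemma prID A B : measurable A -> measurable B ->
  pr A = pr (A `&` B) + pr (A `&` ~` B).
Proof.
move=> mA mB; apply: EFin_inj; rewrite EFinD -!prE//; first last.
- exact: measurableI.
- by apply: measurableI => //; exact: measurableC.
rewrite -measureU ?setIUr -?setIUr ?setUCr ?setIT//.
- exact: measurableI.
- by apply: measurableI => //; exact: measurableC.
- by rewrite setIACA setICr setI0.
Qed.

Lemma prC A : measurable A -> pr (~` A) = 1 - pr A.
Proof.
move=> mA; have := prID measurableT mA; rewrite !setTI prT; lra.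
Qed.

Lemma pr_sub A B C : measurable A -> measurable B -> measurable C ->
  A `<=` B `|` C -> pr A <= pr B + pr C.
Proof.
move=> mA mB mC ABC; rewrite -lee_fin EFinD -!prE//.
apply: le_trans (measureU2 _ mB mC).
by apply: le_measure; rewrite ?inE//; exact: measurableU.
Qed.

Lemma pr_cvg_bigcup (F : (set T)^nat) (e : R) : (forall n, measurable (F n)) ->
  (forall n, F n `<=` F n.+1) -> 0 < e ->
  exists n, pr (\bigcup_k F k) - e < pr (F n).
Proof.
move=> mF ndF e0.
have mU : measurable (\bigcup_k F k) by exact: bigcupT_measurable.
have ndF' : {homo F : n m / (n <= m)%N >-> (n <= m)%O}.
  apply: homo_leq; [by move=> x; exact: lexx|by move=> y x z; exact: le_trans|].
  by move=> n; apply/subsetPset.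
have cF := @nondecreasing_cvg_mu _ _ _ P F mF mU ndF'.
have : fine (P (F n)) @[n --> \oo] --> fine (P (\bigcup_k F k)).
  by apply: fine_cvg; rewrite fineK ?fin_num_measure.
move=> /cvgrPdist_lt/(_ _ e0)[n _ /(_ n (leqnn n))].
by rewrite /= -!/(pr _) => h; exists n; move: h; rewrite ltr_norml; lra.
Qed.

Lemma pr_cvg_bigcap (F : (set T)^nat) (e : R) : (forall n, measurable (F n)) ->
  (forall n, F n.+1 `<=` F n) -> 0 < e ->
  exists n, pr (F n) < pr (\bigcap_k F k) + e.
Proof.
move=> mF niF e0.
have [|n|n] := @pr_cvg_bigcup (fun n => ~` F n) e _ _ e0.
- by move=> n; exact: measurableC.
- exact: subsetC.
rewrite -setC_bigcap !prC//; last exact: bigcapT_measurable.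
by move=> ?; exists n; lra.
Qed.

Lemma pr_ae_le A B : measurable A -> measurable B ->
  {ae P, forall w, A w -> B w} -> pr A <= pr B.
Proof.
move=> mA mB [N [mN N0 HN]].
have prN : pr N = 0 by rewrite /pr N0.
rewrite -[leRHS]addr0 -prN; apply: pr_sub => // w Aw.
have [Bw|nB] := pselect (B w); [by left|right].
by apply: HN => /= /(_ Aw).
Qed.

Lemma pr_ae1 A : measurable A -> {ae P, forall w, A w} -> pr A = 1.
Proof.
move=> mA H; apply/eqP; rewrite eq_le pr_le1// -prT; apply: pr_ae_le => //.
by apply: filterS H => w.
Qed.

Lemma pr1_ae A : measurable A -> pr A = 1 -> {ae P, forall w, A w}.
Proof.
move=> mA A1; exists (~` A); split => //; first exact: measurableC.
by rewrite prE ?prC ?A1 ?subrr//; exact: measurableC.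
Qed.

Lemma mu_ext_ae_le (A B : set T) : {ae P, forall w, A w -> B w} ->
  (mu_ext P A <= mu_ext P B)%E.
Proof.
move=> [N [mN N0 HN]].
have NE : (mu_ext P N = 0)%E by rewrite measurable_mu_extE.
apply: (@le_trans _ _ (mu_ext P B + mu_ext P N)%E); last by rewrite NE adde0.
apply: le_trans (outer_measureU2 _ _ _); apply: le_mu_ext => w Aw.
have [Bw|nB] := pselect (B w); [by left|right].
by apply: HN => /= /(_ Aw).
Qed.

(** The outer measure is monotone up to null sets, so an event over uncountably many times receives
    the probability of an almost surely equal dyadic event. *)
Lemma mu_ext_ae A B : measurable B -> {ae P, forall w, A w <-> B w} ->
  mu_ext P A = (pr B)%:E.
Proof.
move=> mB H; rewrite -prE// -measurable_mu_extE//; apply/eqP; rewrite eq_le.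
by apply/andP; split; apply: mu_ext_ae_le; apply: filterS H => w [].
Qed.

End real_probability.

(** * First visits and a zero-one law *)

Section discrete_filtrations.
Context d (T : measurableType d) (R : realType) (P : probability T R).
Variable G : nat -> set (set T).
Hypothesis sG : forall n, sigma_algebra setT (G n).
Hypothesis mG : forall n A, G n A -> measurable A.
Hypothesis ndG : forall n, G n `<=` G n.+1.

Let ndG_le m n : (m <= n)%N -> G m `<=` G n.
Proof.
move=> /subnK <-; elim: (n - m)%N => [|k IH]; first by rewrite add0n.
by apply: subset_trans IH _; rewrite addSn; exact: ndG.
Qed.

Definition hit (H : nat -> set T) (l n : nat) : set T :=
  [set w | exists2 k, (l <= k < l + n)%N & H k w].

Lemma measurable_hit (H : nat -> set T) l n :
  (forall k, measurable (H k)) -> measurable (hit H l n).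
Proof.
move=> mH; rewrite (_ : hit H l n = \bigcup_(k in [set k | (l <= k < l + n)%N]) H k).
  by apply: bigcup_measurable => k _; exact: mH.
by apply/seteqP; split=> w [k hk Hk]; exists k.
Qed.

(* Split according to whether [H l] occurs, the first index at which it may. *)
Lemma first_hit (H : nat -> set T) (I : set T) (p : R) :
  (forall l, G l (H l)) -> measurable I ->
  (forall l A, G l A -> A `<=` H l -> p * pr P A <= pr P (A `&` I)) ->
  forall n l A, G l A ->
  p * pr P (A `&` hit H l n) <= pr P (A `&` hit H l n `&` I).
Proof.
move=> GH mI step; elim=> [|n IH] l A GA.
  rewrite (_ : hit H l 0 = set0); last first.
    by rewrite -subset0 => w [k]; rewrite addn0 => /andP[lk /(leq_ltn_trans lk)]; rewrite ltnn.
  by rewrite setI0 set0I /pr measure0/= mulr0.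
have mA := mG GA.
have mH k : measurable (H k) by exact: mG (GH k).
have mh k q : measurable (hit H k q) by exact: measurable_hit.
have mHC := measurableC (mH l).
have E1 : A `&` hit H l n.+1 `&` H l = A `&` H l.
  apply/seteqP; split=> w [].
    by move=> [].
  by move=> Aw Hw; split => //; split => //; exists l => //; rewrite leqnn addnS ltnS leq_addr.
have E2 : A `&` hit H l n.+1 `&` ~` H l = A `&` ~` H l `&` hit H l.+1 n.
  apply/seteqP; split=> w [].
    move=> [Aw [k /andP[lk kl] Hk]] Hl; split => //; exists k => //.
    rewrite addSnnS kl andbT ltn_neqAle lk andbT.
    by apply/eqP => lk'; apply: Hl; rewrite lk'.
  move=> [Aw Hl] [k /andP[lk kl] Hk]; split => //; split => //; exists k => //.
  by rewrite -addSnnS kl ltnW.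
rewrite (@prID _ _ _ P (A `&` hit H l n.+1) (H l))//; last exact: measurableI.
rewrite (@prID _ _ _ P (A `&` hit H l n.+1 `&` I) (H l))//; last first.
  by apply: measurableI => //; exact: measurableI.
rewrite ![A `&` hit H l n.+1 `&` I `&` _]setIAC E1 E2 mulrDr lerD//.
  apply: (step l); first exact: salgI.
  by move=> w [].
apply: IH; apply: salgI => //; first exact: ndG.
by apply: salgC => //; exact: ndG.
Qed.

(** Closeness is measured by the symmetric difference. These sets form a sigma-algebra, so they
    include everything generated by the [G n] together. *)
Definition approximable : set (set T) := [set A | measurable A /\
  forall e : R, 0 < e -> exists n B, [/\ G n B, pr P (A `&` ~` B) <= e &
                                     pr P (B `&` ~` A) <= e]].

Let approximableU A B : approximable A -> approximable B -> approximable (A `|` B).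
Proof.
move=> [mA aA] [mB aB]; split; first exact: measurableU.
move=> e e0.
have e2 : 0 < e / 2 by rewrite divr_gt0.
have [n [A' [GA' A1 A2]]] := aA _ e2.
have [m [B' [GB' B1 B2]]] := aB _ e2.
have mA' := mG GA'; have mB' := mG GB'.
have mAC := measurableC mA; have mBC := measurableC mB.
have mA'C := measurableC mA'; have mB'C := measurableC mB'.
exists (maxn n m), (A' `|` B'); split.
- apply: salgU => //.
    exact: ndG_le (leq_maxl _ _) _ GA'.
  exact: ndG_le (leq_maxr _ _) _ GB'.
- rewrite (splitr e); apply: le_trans (lerD A1 B1).
  apply: pr_sub; [|exact: measurableI|exact: measurableI|].
    by apply: measurableI; [exact: measurableU|apply: measurableC; exact: measurableU].
  by move=> w [[]Aw /not_orP[nA nB]]; [left|right].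
- rewrite (splitr e); apply: le_trans (lerD A2 B2).
  apply: pr_sub; [|exact: measurableI|exact: measurableI|].
    by apply: measurableI; [exact: measurableU|apply: measurableC; exact: measurableU].
  by move=> w [[]Aw /not_orP[nA nB]]; [left|right].
Qed.

Let approximable_sigma : sigma_algebra setT approximable.
Proof.
have a0 : approximable set0.
  split=> // e e0; exists 0%N, set0; rewrite set0I /pr measure0.
  by split; [by case: (sG 0%N)|exact: ltW|exact: ltW].
split => //.
- move=> A [mA aA]; rewrite setTD; split; first exact: measurableC.
  move=> e /aA[n [B [GB h1 h2]]]; exists n, (~` B); split; first exact: salgC.
    by rewrite setCK setIC.
  by rewrite setCK setIC.
(* The countable union is cut to a finite one at a cost of [e / 2], and the finite one is
   approximated up to another [e / 2]. *)
- move=> F aF; pose V n := \big[setU/set0]_(k < n) F k.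
  have mF n : measurable (F n) by case: (aF n).
  have aV n : approximable (V n).
    rewrite /V; elim: n => [|n IH]; first by rewrite big_ord0.
    by rewrite big_ord_recr; apply: approximableU => //; exact: aF.
  have mV n : measurable (V n) by case: (aV n).
  have VU : \bigcup_n V n = \bigcup_n F n.
    apply/seteqP; split=> w [n _].
      rewrite /V -bigcup_mkord => -[k _ Fk]; by exists k.
    by move=> Fn; exists n.+1 => //; rewrite /V -bigcup_mkord; exists n => /=.
  have mU : measurable (\bigcup_n F n) by exact: bigcupT_measurable.
  split => // e e0.
  have e2 : 0 < e / 2 by rewrite divr_gt0.
  have [|n hn] := @pr_cvg_bigcup _ _ _ P V (e / 2) mV _ e2.
    by move=> n w; rewrite /V big_ord_recr/=; left.
  have [_ /(_ _ e2)[m [B [GB h1 h2]]]] := aV n.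
  have mB := mG GB; have mBC := measurableC mB.
  have VnU : V n `<=` \bigcup_k F k by rewrite -VU => w Vw; exists n.
  exists m, B; split => //.
    have : pr P (\bigcup_k F k `&` ~` V n) <= e / 2.
      have := @prID _ _ _ P _ _ mU (mV n).
      rewrite (setIidr VnU); move: hn; rewrite VU; lra.
    have : pr P (\bigcup_k F k `&` ~` B) <=
        pr P (\bigcup_k F k `&` ~` V n) + pr P (V n `&` ~` B).
      apply: pr_sub; [exact: measurableI| |exact: measurableI|].
        by apply: measurableI => //; exact: measurableC.
      move=> w [Uw nB]; have [Vw|nV] := pselect (V n w); by [right|left].
    lra.
  apply: (@le_trans _ _ (pr P (B `&` ~` V n))); last lra.
  apply: le_pr.
  - by apply: measurableI => //; exact: measurableC.
  - by apply: measurableI => //; exact: measurableC.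
  - by move=> w [Bw nU]; split => // /VnU.
Qed.

(* If [B] in [G n] approximates [~` E], then [p * pr P B <= pr P (B `&` E)] is small. *)
Lemma zero_one (E : set T) (p : R) : <<s \bigcup_n G n >> E -> 0 < p ->
  (forall n A, G n A -> p * pr P A <= pr P (A `&` E)) -> pr P E = 1.
Proof.
move=> sE p0 HE.
have [mE aE] : approximable E.
  apply: sE; split; first exact: approximable_sigma.
  move=> A [n _ GA]; split; first exact: mG GA.
  by move=> e e0; exists n, A; rewrite setICr /pr measure0; split => //; exact: ltW.
have mEC := measurableC mE.
suff : pr P (~` E) <= 0.
  by have := pr_ge0 P (~` E); rewrite prC//; lra.
apply/ler_addgt0Pr => e e0; rewrite add0r.
(* The approximation costs [e'] and the inequality for the complement of [B] costs [e' / p]; their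
   sum is [e]. *)
pose e' := e / (1 + p^-1).
have q0 : 0 < 1 + p^-1 by rewrite addr_gt0// invr_gt0.
have e'0 : 0 < e' by rewrite divr_gt0.
have [n [B [GB h1 h2]]] := aE _ e'0.
have mB := mG GB; have mBC := measurableC mB.
have GBC : G n (~` B) by exact: salgC.
have := HE _ _ GBC; rewrite setIC => h3.
have h4 : pr P (~` B) <= e' / p by rewrite ler_pdivlMr// mulrC (le_trans h3).
have eE : e' + e' / p = e by rewrite -[X in X + _]mulr1 -mulrDr divfK// gt_eqF.
rewrite -eE; apply: (le_trans _ (lerD h2 h4)); apply: pr_sub => //; first exact: measurableI.
by move=> w nE; have [Bw|nB] := pselect (B w); [left|right].
Qed.

End discrete_filtrations.

(** * Independence *)

Section independent_pairs.
Context d (T : measurableType d) (R : realType) (P : probability T R).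
Local Open Scope ereal_scope.

Definition independent_pair (X Y : T -> R) := forall A B, measurable A ->
  measurable B -> P (X @^-1` A `&` Y @^-1` B) = P (X @^-1` A) * P (Y @^-1` B).

Lemma independent_pair_law (X Y : {mfun T >-> R}) (C : set (R * R)) :
  independent_pair X Y -> measurable C ->
  (distribution P X \x distribution P Y) C = P ((fun w => (X w, Y w)) @^-1` C).
Proof.
move=> XY mC.
have mXY : measurable_fun setT (fun w => (X w, Y w)) by exact: measurable_fun_pair.
pose XYm : {mfun T >-> (R * R)%type} :=
  HB.pack (fun w => (X w, Y w)) (isMeasurableFun.Build _ _ _ _ _ mXY).
rewrite (@product_measure_unique _ _ _ _ _ _ _ (distribution P XYm))//.
Qed.

Lemma independent_pair_integral (X Y : {mfun T >-> R}) (f : R * R -> \bar R) :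
  independent_pair X Y -> measurable_fun setT f -> (forall z, 0 <= f z) ->
  \int[P]_w f (X w, Y w) = \int[P]_v \int[P]_w f (X w, Y v).
Proof.
move=> XY mf f0.
have mXY : measurable_fun setT (fun w => (X w, Y w)) by exact: measurable_fun_pair.
pose XYm : {mfun T >-> (R * R)%type} :=
  HB.pack (fun w => (X w, Y w)) (isMeasurableFun.Build _ _ _ _ _ mXY).
transitivity (\int[distribution P XYm]_z f z).
  by rewrite ge0_integral_distribution.
transitivity (\int[distribution P X \x distribution P Y]_z f z).
  apply: eq_measure_integral => A mA _ /=.
  by rewrite [RHS]independent_pair_law.
rewrite fubini_tonelli2//.
have mg : measurable_fun setT (fun y => \int[distribution P X]_x f (x, y)).
  exact: measurable_fun_fubini_tonelli_G.
rewrite ge0_integral_distribution//; last by move=> y; exact: integral_ge0.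
apply: eq_integral => v _.
apply: (ge0_integral_distribution X (f := fun x => f (x, Y v))) => //.
exact: measurableT_comp.
Qed.

End independent_pairs.

Section independent_sequences.
Context d (T : measurableType d) (R : realType) (P : probability T R).
Variable xi : nat -> T -> R.
Hypothesis mxi : forall k, measurable_fun setT (xi k).

Let mpre k B : measurable B -> measurable (xi k @^-1` B).
Proof. by move=> mB; rewrite -[X in measurable X]setTI; exact: mxi. Qed.

Definition box (B : nat -> set R) (n : nat) : set T :=
  [set w | forall k, (k < n)%N -> B k (xi k w)].

(** Initial segments of indices suffice, since choosing [B k = setT] removes the index [k]. *)
Definition independent_seq := forall n (B : nat -> set R),
  (forall k, measurable (B k)) ->
  pr P (box B n) = \prod_(k < n) pr P (xi k @^-1` B k).

Definition seq_generator (J : set nat) : set (set T) :=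
  [set A | exists j B, [/\ J j, measurable B & A = xi j @^-1` B]].

Definition seq_sigma (J : set nat) : set (set T) := <<s seq_generator J >>.

Lemma seq_sigma_algebra J : sigma_algebra setT (seq_sigma J).
Proof. exact: smallest_sigma_algebra. Qed.

Lemma seq_sigma_measurable J A : seq_sigma J A -> measurable A.
Proof.
apply; split; first exact: sigma_algebra_measurable.
by move=> _ [j [B [_ mB ->]]]; exact: mpre.
Qed.

Lemma seq_sigmaS J J' : J `<=` J' -> seq_sigma J `<=` seq_sigma J'.
Proof.
move=> JJ' A; apply; split; first exact: smallest_sigma_algebra.
move=> _ [j [B [Jj mB ->]]].
by apply: sub_sigma_algebra; exists j, B; split => //; exact: JJ'.
Qed.

(** Cylinders over [J], a pi-system generating [seq_sigma J]. Filling the other indices with [setT]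
    lets cylinders over two index sets be written with one common length. *)
Definition boxes (J : set nat) : set (set T) :=
  [set A | exists n B, [/\ forall k, measurable (B k),
     forall k, ~ J k -> B k = setT & A = box B n]].

Lemma box_extend (B : nat -> set R) n m : (n <= m)%N ->
  box B n = box (fun k => if (k < n)%N then B k else setT) m.
Proof.
move=> nm; apply/seteqP; split=> w H k; first by case: ifP => // kn _; exact: H.
by move=> kn; have := H k (leq_trans kn nm); rewrite kn.
Qed.

Lemma boxes_common J J' A A' : boxes J A -> boxes J' A' ->
  exists n B B', [/\ (forall k, measurable (B k)) /\ (forall k, measurable (B' k)),
    forall k, ~ J k -> B k = setT, forall k, ~ J' k -> B' k = setT,
    A = box B n & A' = box B' n].
Proof.
move=> [n [B [mB BJ ->]]] [n' [B' [mB' BJ' ->]]].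
exists (maxn n n'), (fun k => if (k < n)%N then B k else setT),
  (fun k => if (k < n')%N then B' k else setT); split.
- by split=> k; case: ifP.
- by move=> k /BJ; case: ifP.
- by move=> k /BJ'; case: ifP.
- exact/box_extend/leq_maxl.
- exact/box_extend/leq_maxr.
Qed.

Lemma boxI B B' n : box B n `&` box B' n = box (fun k => B k `&` B' k) n.
Proof.
apply/seteqP; split=> w; first by move=> [h h'] k kn; split; [exact: h|exact: h'].
by move=> h; split=> k kn; have [] := h k kn.
Qed.

Lemma boxes_setI J : setI_closed (boxes J).
Proof.
move=> A A' bA bA'; have [n [B [B' [[mB mB'] BJ BJ' -> ->]]]] := boxes_common bA bA'.
exists n, (fun k => B k `&` B' k); split; last exact: boxI.
- by move=> k; exact: measurableI.
- by move=> k nJ; rewrite BJ// BJ'// setTI.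
Qed.

Lemma measurable_box B n : (forall k, measurable (B k)) -> measurable (box B n).
Proof.
move=> mB; rewrite (_ : box B n = \bigcap_k [set w | (k < n)%N -> B k (xi k w)]).
  apply: bigcapT_measurable => k.
  apply: (salg_imp (sigma_algebra_measurable T)) => _; exact: mpre.
by apply/seteqP; split=> w h k => [_|] kn; exact: h.
Qed.

Lemma boxesT J : boxes J setT.
Proof.
exists 0%N, (fun=> setT); split => //.
by apply/seteqP; split.
Qed.

Lemma seq_sigma_boxes J : seq_sigma J `<=` <<s boxes J >>.
Proof.
move=> A; apply; split; first exact: smallest_sigma_algebra.
move=> _ [j [B [Jj mB ->]]]; apply: sub_sigma_algebra.
exists j.+1, (fun k => if k == j then B else setT); split.
- by move=> k; case: ifP.
- by move=> k nJ; case: eqP => // kj; rewrite kj in nJ.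
- apply/seteqP; split=> w /=; first by move=> Bw k _; case: eqP => // ->.
  by move=> /(_ j (ltnSn j)); rewrite eqxx.
Qed.

(* Both sides are finite measures in [A]. *)
Lemma independent_extend (G : set (set T)) (B : set T) : G `<=` measurable ->
  setI_closed G -> G setT -> measurable B ->
  (forall A, G A -> pr P (A `&` B) = pr P A * pr P B) ->
  forall A, <<s G >> A -> measurable A -> pr P (A `&` B) = pr P A * pr P B.
Proof.
move=> Gm GI GT mB GB A sA mA.
have b0 : 0 <= pr P B by exact: pr_ge0.
pose m2 := mscale (NngNum b0) P.
have m1E E : measurable E -> mrestr P mB E = (pr P (E `&` B))%:E.
  by move=> mE; rewrite -[RHS]prE//; exact: measurableI.
have m2E E : measurable E -> m2 E = (pr P B * pr P E)%:E.
  by move=> mE; rewrite EFinM -(@prE _ _ _ P E).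
apply: EFin_inj; rewrite -m1E// mulrC -m2E//.
apply: (g_sigma_algebra_measure_unique G Gm (fun=> setT)) => //.
- by apply/seteqP; split=> w // _; exists 0%N.
- by move=> E GE; have mE := Gm _ GE; rewrite [LHS]m1E// [RHS]m2E// GB// mulrC.
- by move=> k; rewrite [X in (X < _)%E]m1E// ltry.
Qed.

Hypothesis ind : independent_seq.

(** For cylinders the product formula holds index by index, because at each index one of the two
    sets is [setT]. [independent_extend] then passes to the sigma-algebras, one argument at a
    time. *)
Lemma independent_blocks J J' A B : (forall k, J k -> ~ J' k) ->
  seq_sigma J A -> seq_sigma J' B -> pr P (A `&` B) = pr P A * pr P B.
Proof.
move=> JJ' sA sB.
have mA := seq_sigma_measurable sA; have mB := seq_sigma_measurable sB.
have bm K : boxes K `<=` measurable by move=> _ [n [C [mC _ ->]]]; exact: measurable_box.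
have bb A' B' : boxes J A' -> boxes J' B' -> pr P (A' `&` B') = pr P A' * pr P B'.
  move=> bA bB; have [n [C [C' [[mC mC'] CJ CJ' -> ->]]]] := boxes_common bA bB.
  rewrite boxI !ind//; last by move=> k; exact: measurableI.
  rewrite -big_split; apply: eq_bigr => k _ /=.
  have [Jk|nJ] := pselect (J k).
    by rewrite (CJ' _ (JJ' _ Jk)) setIT preimage_setT prT mulr1.
  by rewrite (CJ _ nJ) setTI preimage_setT prT mul1r.
apply: (@independent_extend (boxes J)) => //;
  [exact: boxes_setI|exact: boxesT| |exact: seq_sigma_boxes].
move=> A' bA'; rewrite setIC mulrC.
apply: (@independent_extend (boxes J')) => //;
  [exact: boxes_setI|exact: boxesT|exact: bm bA'| |exact: seq_sigma_boxes].
by move=> B' bB'; rewrite setIC mulrC; exact: bb.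
Qed.

Lemma seq_sigma_fun J k B : J k -> measurable B -> seq_sigma J (xi k @^-1` B).
Proof. by move=> Jk mB; apply: sub_sigma_algebra; exists k, B. Qed.

End independent_sequences.

Section random_walks.
Context d (T : measurableType d) (R : realType) (P : probability T R).
Variable xi : nat -> T -> R.

(* The maximum of the first [n] partial sums started at index [k], and 0; recursion on
   the first step makes it a function of [xi k] and of the independent later steps. *)
Fixpoint walk_max (n k : nat) (w : T) : R :=
  if n is n'.+1 then Num.max 0 (xi k w + walk_max n' k.+1 w) else 0.

Lemma walk_max_ge0 n k w : 0 <= walk_max n k w.
Proof. by case: n => //= n; rewrite le_max lexx. Qed.

Lemma walk_maxS n k w : walk_max n k w <= walk_max n.+1 k w.
Proof.
elim: n k => [|n IH] k; first exact: walk_max_ge0.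
by rewrite /= ge_max le_max lexx/= le_max lerD2l IH orbT.
Qed.

Lemma walk_le_max n k w : \sum_(k <= j < k + n) xi j w <= walk_max n k w.
Proof.
elim: n k => [|n IH] k; first by rewrite addn0 big_geq.
rewrite big_ltn ?addnS ?ltnS ?leq_addr// -addSn /=.
by rewrite le_max lerD2l IH orbT.
Qed.

Lemma measurable_walk_max (G : set (set T)) n k :
  (forall j, (k <= j)%N -> forall B, measurable B -> <<s G >> (xi j @^-1` B)) ->
  forall B, measurable B -> <<s G >> (walk_max n k @^-1` B).
Proof.
move=> mxi.
suff H : measurable_fun (setT : set (g_sigma_algebraType G)) (walk_max n k).
  by move=> B mB; rewrite -[X in <<s _ >> X]setTI; exact: H.
elim: n k mxi => [|n IH] k mxi /=; first exact: measurable_cst.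
apply: measurable_maxr; first exact: measurable_cst.
apply: measurable_funD.
  by move=> _ B mB; rewrite setTI; exact: mxi.
by apply: IH => j kj; apply: mxi; exact: ltnW.
Qed.

(** Boundedness does not depend on the first [k] steps, which makes it accessible to [zero_one]. *)
Lemma walk_max_bounded_shift k w :
  (exists x, forall n, walk_max n k w <= x) -> exists x, forall n, walk_max n 0 w <= x.
Proof.
elim: k => // k IH [x Hx]; apply: IH; exists (Num.max 0 (xi k w + x)) => -[|n] /=.
  by rewrite le_max lexx.
by rewrite ge_max !le_max lexx/= lerD2l Hx orbT.
Qed.

End random_walks.

Section expectations.
Context d (T : measurableType d) (R : realType) (P : probability T R).

Definition mfun_of (f : T -> R) (mf : measurable_fun setT f) : {mfun T >-> R} :=
  HB.pack f (isMeasurableFun.Build _ _ _ _ _ mf).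

Definition same_law (X Y : T -> R) :=
  forall B, measurable B -> P (X @^-1` B) = P (Y @^-1` B).

Lemma same_law_ge0_integral (X Y : T -> R) (f : R -> \bar R) :
  measurable_fun setT X -> measurable_fun setT Y -> same_law X Y ->
  measurable_fun setT f -> (forall x, 0 <= f x)%E ->
  (\int[P]_w f (X w) = \int[P]_w f (Y w))%E.
Proof.
move=> mX mY XY mf f0.
rewrite -(ge0_integral_distribution (mfun_of mX) mf f0).
rewrite -(ge0_integral_distribution (mfun_of mY) mf f0).
by apply: eq_measure_integral => A mA _; exact: XY.
Qed.

Lemma same_law_integrable (X Y : T -> R) :
  measurable_fun setT X -> measurable_fun setT Y -> same_law X Y ->
  P.-integrable setT (EFin \o X) -> P.-integrable setT (EFin \o Y).
Proof.
move=> mX mY XY /integrableP[_ iX]; apply/integrableP; split.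
  exact/measurable_EFinP.
have := @same_law_ge0_integral X Y (fun x => `|x%:E|)%E mX mY XY.
rewrite /= in iX * => <-//.
by apply: measurableT_comp => //; exact/measurable_EFinP.
Qed.

Lemma Rintegral_EFin (f : T -> R) : P.-integrable setT (EFin \o f) ->
  (\int[P]_w (f w)%:E)%E = (\int[P]_w f w)%:E.
Proof. by move=> intf; rewrite /Rintegral fineK//; exact: integrable_fin_num intf. Qed.

Lemma same_law_Rintegral (X Y : T -> R) :
  measurable_fun setT X -> measurable_fun setT Y -> same_law X Y ->
  P.-integrable setT (EFin \o X) -> P.-integrable setT (EFin \o Y) ->
  \int[P]_w X w = \int[P]_w Y w.
Proof.
move=> mX mY XY iX iY; apply: EFin_inj; rewrite -!Rintegral_EFin//.
have mid : measurable_fun setT (EFin : R -> \bar R) by exact/measurable_EFinP.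
rewrite -(integral_distribution (X := mfun_of mX) mid iX).
rewrite -(integral_distribution (X := mfun_of mY) mid iY).
by apply: eq_measure_integral => A mA _; exact: XY.
Qed.

Lemma integrable_dominated (f g : T -> R) : measurable_fun setT f ->
  (forall w, `|f w| <= `|g w|) -> P.-integrable setT (EFin \o g) ->
  P.-integrable setT (EFin \o f).
Proof.
move=> mf fg; apply: le_integrable => //; first exact/measurable_EFinP.
by move=> w _ /=; rewrite lee_fin.
Qed.

Lemma integrable_cst_prob (c : R) : P.-integrable setT (EFin \o (cst c : T -> R)).
Proof. exact: finite_measure_integrable_cst. Qed.

Lemma integrable_add (f g : T -> R) : P.-integrable setT (EFin \o f) ->
  P.-integrable setT (EFin \o g) -> P.-integrable setT (EFin \o (fun w => f w + g w)).
Proof. by move=> intf intg; exact: (integrableD measurableT intf intg). Qed.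

Lemma integrable_max_cst (c : R) (f : T -> R) : measurable_fun setT f ->
  P.-integrable setT (EFin \o f) ->
  P.-integrable setT (EFin \o (fun w => Num.max c (f w))).
Proof.
move=> mf intf.
apply: (@integrable_dominated _ (fun w => `|c| + `|f w|)).
- by apply: measurable_maxr => //; exact: measurable_cst.
- move=> w; rewrite [leRHS]ger0_norm ?addr_ge0//.
  case: (leP c (f w)) => _; first by rewrite lerDr.
  by rewrite lerDl.
- apply: integrable_add; first exact: integrable_cst_prob.
  exact: (integrable_norm intf).
Qed.

End expectations.

(** * Random walks and Levy processes *)

Lemma set_le_preimage (T : Type) (R : realType) (f : T -> R) (y : R) :
  [set w | f w <= y] = f @^-1` [set` `]-oo, y]].
Proof. by apply/seteqP; split=> w /=; rewrite in_itv. Qed.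

Section negative_drift_walk.
Context d (T : measurableType d) (R : realType) (P : probability T R).
Variable xi : nat -> T -> R.
Hypothesis mxi : forall k, measurable_fun setT (xi k).
Hypothesis ind : independent_seq P xi.
Hypothesis idd : forall k, same_law P (xi k) (xi 0%N).
Hypothesis int0 : P.-integrable setT (EFin \o xi 0%N).
Hypothesis drift : (\int[P]_w xi 0%N w < 0).

Let M n k := walk_max xi n k.

Let mM n k : measurable_fun setT (M n k).
Proof.
elim: n k => [|n IH] k; first exact: measurable_cst.
apply: measurable_maxr; first exact: measurable_cst.
by apply: measurable_funD => //; exact: IH.
Qed.

Let intxi k : P.-integrable setT (EFin \o xi k).
Proof. by apply: same_law_integrable int0 => // B mB; rewrite idd. Qed.

Let intM n k : P.-integrable setT (EFin \o M n k).
Proof.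
elim: n k => [|n IH] k; first exact: integrable_cst_prob.
apply: integrable_max_cst; last by apply: integrable_add => //; exact: IH.
by apply: measurable_funD => //; exact: mM.
Qed.

Let sigma_M (J : set nat) n k B : (forall j, (k <= j)%N -> J j) -> measurable B ->
  seq_sigma xi J (M n k @^-1` B).
Proof.
move=> Jk mB; apply: measurable_walk_max => // j kj C mC.
by apply: seq_sigma_fun => //; exact: Jk.
Qed.

Let ind_pair n k : independent_pair P (xi k) (M n k.+1).
Proof.
move=> A B mA mB.
have mA' : measurable (xi k @^-1` A) by rewrite -[X in measurable X]setTI; exact: mxi.
have mB' : measurable (M n k.+1 @^-1` B) by rewrite -[X in measurable X]setTI; exact: mM.
rewrite !(@prE _ _ _ P)//; last exact: measurableI.
rewrite -EFinM; congr EFin.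
apply: (independent_blocks mxi ind (J := [set k]) (J' := [set j | (k < j)%N])).
- by move=> _ -> /=; rewrite ltnn.
- exact: seq_sigma_fun.
- exact: sigma_M.
Qed.

(** The law of [M n.+1 k] is an image of the product of the laws of [xi k] and [M n k.+1]; by
    induction neither factor depends on [k]. *)
Let M_same_law n k : same_law P (M n k) (M n 0%N).
Proof.
elim: n k => [//|n IH] k B mB.
pose C := [set z : R * R | B (Num.max 0 (z.1 + z.2))].
have mf : measurable_fun setT (fun z : R * R => Num.max 0 (z.1 + z.2)).
  apply: measurable_maxr; first exact: measurable_cst.
  by apply: measurable_funD; [exact: measurable_fst|exact: measurable_snd].
have mC : measurable C by rewrite -[C]setTI; exact: mf.
pose X k := mfun_of (mxi k); pose Y k := mfun_of (mM n k).
have h k' : P (M n.+1 k' @^-1` B) =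
    (distribution P (X k') \x distribution P (Y k'.+1))%E C.
  by rewrite independent_pair_law//; exact: ind_pair.
rewrite !h; apply: product_measure_unique => // A A' mA mA'.
etransitivity; first exact: product_measure1E.
congr (_ * _)%E.
  exact: (esym (idd k mA)).
exact: etrans (IH 1%N A' mA') (esym (IH k.+1 A' mA')).
Qed.

Let EM n k : \int[P]_w M n k w = \int[P]_w M n 0%N w.
Proof.
apply: EFin_inj; rewrite -!Rintegral_EFin//.
have h j w : (M n j w)%:E = (fun x : R => (Num.max 0 x)%:E) (M n j w).
  by rewrite /= max_r// walk_max_ge0.
under eq_integral do rewrite h.
under [RHS]eq_integral do rewrite h.
apply: (same_law_ge0_integral (f := fun x : R => (Num.max 0 x)%:E)) => //; last first.
  by move=> x; rewrite lee_fin le_max lexx.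
apply/measurable_EFinP.
by apply: measurable_maxr; [exact: measurable_cst|exact: measurable_id].
Qed.

(** Prepending a step to a later maximum [m] changes its mean by the mean of the step truncated
    below at [- m]: at most [a] always, and at most [- b y] when [m > y]. *)
Let a := \int[P]_w Num.max 0 (xi 0%N w).
Let b (y : R) := - \int[P]_w Num.max (- y) (xi 0%N w).

Let a_ge0 : 0 <= a.
Proof. by apply: Rintegral_ge0 => w _; rewrite le_max lexx. Qed.

(** By dominated convergence the truncated means tend to the mean of the step, which is negative. *)
Let b_gt0 : exists y, 0 < b y /\ 0 <= y.
Proof.
pose f (n : nat) w := (Num.max (- n%:R) (xi 0%N w))%:E.
have mf n : measurable_fun setT (f n).
  by apply/measurable_EFinP; apply: measurable_maxr.
have [||||_ _] := @dominated_convergence _ _ _ P setT measurableT f (EFin \o xi 0%N)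
    (fun w => `|(xi 0%N w)%:E|)%E mf.
- exact/measurable_EFinP.
- apply: aeW => w _; apply: cvg_near_cst.
  exists (Num.truncn `|xi 0%N w|).+1 => // n /= hn; rewrite /f max_r//.
  rewrite lerNl; apply: (le_trans (ler_norm _)); rewrite normrN.
  by rewrite (le_trans (ltW (truncnS_gt _)))// ler_nat.
- exact: (integrable_norm int0).
- apply: aeW => w n _; rewrite /f/= lee_fin.
  case: (leP (- n%:R) (xi 0%N w)) => // h; rewrite normrN ger0_norm//.
  by rewrite (@le_trans _ _ (- xi 0%N w))//; [rewrite lerNr ltW|rewrite -normrN ler_norm].
rewrite Rintegral_EFin// => /fine_cvgP[_ /cvgr_lt/(_ 0 drift)][n _ /(_ n (leqnn n))].
by rewrite /= => h; exists n%:R; split => //; rewrite /b oppr_gt0.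
Qed.

Let meas_le n k y : measurable [set w | M n k w <= y].
Proof.
by rewrite set_le_preimage -[X in measurable X]setTI; exact: mM.
Qed.

(* [M n.+1 0 = max 0 (xi 0 + M n 1)], where [M n 1] is independent of [xi 0] and
   has the law of [M n 0 <= M n.+1 0].  So the mean of [max (- M n 1) (xi 0)] is
   nonnegative, which bounds the probability that [M n 1] is large. *)
Let M_le n y : 0 <= y -> b y <= (a + b y) * pr P [set w | M n 1%N w <= y].
Proof.
move=> y0.
set p := pr P _.
have inner v : (\int[P]_w (Num.max 0 (xi 0%N w + M n 1%N v))%:E <=
   (M n 1%N v + (a + b y) * \1_[set w | M n 1%N w <= y] v - b y)%:E)%E.
  have m0 := walk_max_ge0 xi n 1 v; rewrite -/(M n 1%N v) in m0.
  have mS : measurable_fun setT (fun w => xi 0%N w + M n 1%N v).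
    by apply: measurable_funD => //; exact: measurable_cst.
  have iS : P.-integrable setT (EFin \o (fun w => Num.max 0 (xi 0%N w + M n 1%N v))).
    apply: integrable_max_cst => //.
    by apply: integrable_add => //; exact: integrable_cst_prob.
  have iC c : P.-integrable setT (EFin \o (fun w => Num.max c (xi 0%N w))).
    exact: integrable_max_cst.
  rewrite Rintegral_EFin// lee_fin indicE.
  have bound c : c <= 0 -> - M n 1%N v <= c ->
      \int[P]_w Num.max 0 (xi 0%N w + M n 1%N v) <=
      \int[P]_w Num.max c (xi 0%N w) + M n 1%N v.
    move=> c0 Mc; rewrite -[X in _ <= _ + X]mulr1 -(prT P) -Rintegral_cst//.
    rewrite -RintegralD//; last exact: integrable_cst_prob.
    apply: le_Rintegral => //.
      by apply: integrable_add => //; exact: integrable_cst_prob.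
    move=> w _; rewrite ge_max -{1}(subrr (M n 1%N v)) addrC !lerD2r !le_max lexx orbT.
    by rewrite Mc.
  have [My|My] := leP (M n 1%N v) y.
    rewrite mem_set//= mulr1; apply: le_trans (bound 0 _ _) _ => //.
      by rewrite oppr_le0.
    by rewrite -/a; lra.
  rewrite memNset//=; last by apply/negP; rewrite -ltNge.
  rewrite mulr0 addr0; apply: le_trans (bound (- y) _ _) _.
  - by rewrite oppr_le0.
  - by rewrite lerN2 ltW.
  - by rewrite /b opprK addrC.
have iI : P.-integrable setT (EFin \o (\1_[set w | M n 1%N w <= y] : T -> R)).
  exact: integrable_indic.
have iI2 : P.-integrable setT
    (EFin \o (fun v => (a + b y) * \1_[set w | M n 1%N w <= y] v)).
  exact: (integrableZl measurableT (a + b y) iI).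
have h1 : \int[P]_w M n.+1 0%N w <= \int[P]_w M n 0%N w + (a + b y) * p - b y.
  rewrite -lee_fin -Rintegral_EFin//.
  have -> : (\int[P]_w (M n.+1 0%N w)%:E =
      \int[P]_v \int[P]_w (Num.max 0 (xi 0%N w + M n 1%N v))%:E)%E.
    apply: (@independent_pair_integral _ _ _ P (mfun_of (mxi 0%N)) (mfun_of (mM n 1%N))
      (fun z : R * R => (Num.max 0 (z.1 + z.2))%:E)) => //.
    - exact: ind_pair.
    - apply/measurable_EFinP; apply: measurable_maxr; first exact: measurable_cst.
      by apply: measurable_funD; [exact: measurable_fst|exact: measurable_snd].
    - by move=> z; rewrite lee_fin le_max lexx.
  have -> : \int[P]_w M n 0%N w + (a + b y) * p - b y =
      \int[P]_v (M n 1%N v + (a + b y) * \1_[set w | M n 1%N w <= y] v - b y).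
    rewrite RintegralB//; last 2 first.
    - exact: integrable_add.
    - exact: integrable_cst_prob.
    rewrite RintegralD// EM RintegralZl// Rintegral_cst// -/(pr P setT) prT mulr1.
    by rewrite /Rintegral integral_indic// setIT.
  rewrite -Rintegral_EFin; last first.
    have := integrable_add (integrable_add (intM n 1) iI2) (integrable_cst_prob P (- b y)).
    by [].
  apply: ge0_le_integral => //.
  - by move=> v _; apply: integral_ge0 => w _; rewrite lee_fin le_max lexx.
  - pose f (z : T * T) := (Num.max 0 (xi 0%N z.1 + M n 1%N z.2))%:E.
    apply: (@measurable_fun_fubini_tonelli_G _ _ _ _ _ P f); last first.
      by move=> z; rewrite lee_fin le_max lexx.
    apply/measurable_EFinP; apply: measurable_maxr; first exact: measurable_cst.
    apply: measurable_funD.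
      by apply: measurableT_comp => //; exact: measurable_fst.
    by apply: measurableT_comp => //; exact: measurable_snd.
  - by apply/measurable_EFinP; apply: measurable_funB => //;
      apply: measurable_funD => //; apply: measurable_funM.
have h2 : \int[P]_w M n 0%N w <= \int[P]_w M n.+1 0%N w.
  by apply: le_Rintegral => // w _; exact: walk_maxS.
lra.
Qed.

Lemma walk_bounded (e : R) : 0 < e -> exists x : nat,
  pr P (\bigcup_n [set w | x%:R < \sum_(0 <= j < n) xi j w]) <= e.
Proof.
have [y [by0 y0]] := b_gt0.
(* The bound of [M_le] is the same for all [n] and, by [M_same_law], for all starting indices; in
   the limit the walk started at any [k] stays below [y] forever with probability at least [c]. *)
pose c := b y / (a + b y).
have ab0 : 0 < a + b y by apply: ltr_wpDl.
have c0 : 0 < c by rewrite divr_gt0.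
pose K k := \bigcap_n [set w | M n k w <= y].
have mK k : measurable (K k) by apply: bigcapT_measurable => n; exact: meas_le.
have prK k : c <= pr P (K k).
  apply/ler_addgt0Pr => e' e'0.
  have [//|n w /= h|n hn] :=
    @pr_cvg_bigcap _ _ _ P (fun n => [set w | M n k w <= y]) e' _ _ e'0.
    exact: le_trans (walk_maxS _ _ _ _) h.
  apply: le_trans (ltW hn).
  rewrite /c ler_pdivrMr// mulrC.
  have -> : pr P [set w | M n k w <= y] = pr P [set w | M n 1%N w <= y].
    have h j : pr P [set w | M n j w <= y] = pr P (M n 0%N @^-1` [set` `]-oo, y]]).
      by rewrite /pr -(M_same_law n j)// set_le_preimage.
    by rewrite !h.
  exact: M_le.
pose E := \bigcup_x \bigcap_n [set w | M n 0%N w <= x%:R].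
pose G k := seq_sigma xi [set j | (j < k)%N].
have Ee : <<s \bigcup_n G n >> E.
  have sS := smallest_sigma_algebra setT (\bigcup_n G n).
  apply: (salg_bigcup sS) => x; apply: (salg_bigcap sS) => n.
  rewrite set_le_preimage; apply: measurable_walk_max => // j _ B mB.
  by apply: sub_sigma_algebra; exists j.+1 => //; apply: seq_sigma_fun => /=.
have mE : measurable E.
  by apply: bigcupT_measurable => x; apply: bigcapT_measurable => n; exact: meas_le.
have E1 : pr P E = 1.
  apply: (zero_one (G := G)) Ee c0 _.
  - by move=> n; exact: seq_sigma_algebra.
  - by move=> n A; exact: seq_sigma_measurable.
  - by move=> n; apply: seq_sigmaS => j /= /ltnW.
  (* [K k] involves only the steps from [k] on, hence is independent of [A], and on it the walk is
     bounded whatever the earlier steps were. *)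
  - move=> k A GA; have mA := seq_sigma_measurable mxi GA.
    apply: (@le_trans _ _ (pr P (A `&` K k))).
      rewrite mulrC (independent_blocks mxi ind (J := [set j | (j < k)%N])
        (J' := [set j | (k <= j)%N]))//.
      + by rewrite ler_wpM2l ?pr_ge0.
      + by move=> j /= jk; rewrite leqNgt jk.
      + apply: (salg_bigcap (seq_sigma_algebra _ _)) => n.
        by rewrite set_le_preimage; exact: sigma_M.
    apply: le_pr; [exact: measurableI|exact: measurableI|].
    move=> w [Aw Kw]; split => //.
    have [x Hx] := walk_max_bounded_shift (ex_intro _ y (fun n => Kw n I)).
    exists (Num.truncn x).+1 => // n _ /=.
    by rewrite (le_trans (Hx n))// ltW// truncnS_gt.
move=> e0.
have [|x w|x hx] :=
  @pr_cvg_bigcup _ _ _ P (fun x => \bigcap_n [set w | M n 0%N w <= x%:R]) e _ _ e0.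
- by move=> x; apply: bigcapT_measurable => n; exact: meas_le.
- by move=> h n _ /=; rewrite (le_trans (h n I))// ler_nat.
exists x.
have mx : measurable (\bigcap_n [set w | M n 0%N w <= x%:R]).
  by apply: bigcapT_measurable => k; exact: meas_le.
apply: (@le_trans _ _ (pr P (~` \bigcap_n [set w | M n 0%N w <= x%:R]))).
  apply: le_pr; [apply: bigcupT_measurable => n|exact: measurableC|].
    rewrite -[X in measurable X]setTI; apply: measurable_fun_ltr => //.
    exact: measurable_sum.
  move=> w [n _ /= xn] /(_ n I) /=; apply/negP; rewrite -ltNge (lt_le_trans xn)//.
  exact: (walk_le_max xi n 0).
by rewrite prC//; move: hx; rewrite -/E E1; lra.
Qed.

End negative_drift_walk.

(** * Levy processes with negative drift are bounded above *)

Section levy_bounded_above.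
Context d (T : measurableType d) (R : realType) (P : probability T R).
Variable W : R -> T -> R.

Definition increment (t : nat -> R) (k : nat) (w : T) : R := W (t k.+1) w - W (t k) w.

Hypothesis mW : forall t, 0 <= t -> measurable_fun setT (W t).
Hypothesis W0 : {ae P, forall w, W 0 w = 0}.
Hypothesis indW : forall t : nat -> R, 0 <= t 0%N -> (forall k, t k <= t k.+1) ->
  independent_seq P (increment t).
Hypothesis statW : forall s h, 0 <= s -> 0 <= h ->
  same_law P (fun w => W (s + h) w - W s w) (W h).
Hypothesis cadW : {ae P, forall w, cadlag (W ^~ w)}.
Hypothesis intW : P.-integrable setT (EFin \o W 1).
Hypothesis driftW : \int[P]_w W 1 w < 0.

Let dy_nat n : dy 0 n = n%:R :> R := dy0 R n.

Let dyM q n : dy q (n * 2 ^ q) = n%:R :> R.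
Proof. by rewrite -{1}[q]add0n dyE dy0. Qed.

Let mincr t : (forall k, 0 <= t k) -> forall k, measurable_fun setT (increment t k).
Proof. by move=> t0 k; apply: measurable_funB; exact: mW. Qed.

Let mincr_dy q k : measurable_fun setT (increment (dy q) k).
Proof. by apply: mincr => j; exact: dy_ge0. Qed.

Let ind_dy q : independent_seq P (increment (dy q)).
Proof. by apply: indW => [|k]; [exact: dy_ge0|rewrite ler_dy]. Qed.

Let sum_increment q k n w : (k <= n)%N ->
  \sum_(k <= j < n) increment (dy q) j w = W (dy q n) w - W (dy q k) w.
Proof. by move=> kn; rewrite /increment telescope_sumr. Qed.

Let meas_gt (f : T -> R) c : measurable_fun setT f -> measurable [set w | c < f w].
Proof.
move=> mf; rewrite (_ : [set _ | _] = f @^-1` [set` `]c, +oo[]); last first.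
  by apply/seteqP; split=> w /=; rewrite in_itv/= andbT.
by rewrite -[X in measurable X]setTI; exact: mf.
Qed.

Let skeleton (e : R) : 0 < e -> exists x : R,
  pr P (\bigcup_n [set w | x < W n%:R w - W 0 w]) <= e.
Proof.
move=> e0.
have law1 : same_law P (increment (dy 0) 0%N) (W 1).
  move=> B mB; rewrite -(statW (lexx 0) ler01 mB) /increment !dy_nat.
  by rewrite add0r.
have m1 := mW ler01.
have i1 : P.-integrable setT (EFin \o increment (dy 0) 0%N).
  by apply: same_law_integrable intW => // B mB; rewrite law1.
have [|||x hx] := walk_bounded (fun k => mincr_dy 0 k) (ind_dy 0%N) _ _ _ e0.
- move=> k B mB; rewrite law1// -(statW (dy_ge0 R 0 k) ler01 mB).
  by rewrite /increment !dy_nat natr1.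
- exact: i1.
- by rewrite (same_law_Rintegral (mincr_dy 0%N 0%N) m1 law1).
- exists x%:R; move: hx; congr (pr P _ <= e).
  apply: eq_bigcupr => n _; apply/seteqP; split=> w /=;
    by rewrite sum_increment// !dy_nat.
Qed.

(** A cadlag path is bounded on the unit interval, so one constant works with probability at least
    1/2. By stationarity this controls the fall over any dyadic duration of at most 1, as
    Ottaviani's inequality requires. *)
Let tight : exists a : R, forall q l, dy q l <= 1 :> R ->
  2^-1 <= pr P [set w | - a <= W (dy q l) w].
Proof.
pose K (C : nat) := \bigcap_q \bigcap_l
  [set w | dy q l <= 1 :> R -> `|W (dy q l) w| <= C%:R].
have mabs q l C : measurable [set w | `|W (dy q l) w| <= C%:R].
  rewrite set_le_preimage -[X in measurable X]setTI.
  by apply: measurableT_comp => //; apply: mW; exact: dy_ge0.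
have mK C : measurable (K C).
  apply: bigcapT_measurable => q; apply: bigcapT_measurable => l.
  by apply: (salg_imp (sigma_algebra_measurable T)) => _; exact: mabs.
have half0 : (0 : R) < 2^-1 by rewrite invr_gt0.
have [C w H q _ l _ /= h|C hC] := @pr_cvg_bigcup _ _ _ P K 2^-1 mK _ half0.
  by rewrite (le_trans (H q I l I h))// ler_nat.
have U1 : pr P (\bigcup_C K C) = 1.
  apply: pr_ae1; first exact: bigcupT_measurable.
  apply: filterS cadW => w cw.
  have [C' HC'] := cadlag_bounded cw ler01.
  by exists C' => // q _ l _ /= h; apply: HC'; rewrite dy_ge0.
exists C%:R => q l ql.
have -> : 2^-1 = pr P (\bigcup_C K C) - 2^-1 :> R by rewrite U1; lra.
apply: (le_trans (ltW hC)); apply: le_pr => //.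
  rewrite (_ : [set w | _] = [set w | - W (dy q l) w <= C%:R]); last first.
    by apply/seteqP; split=> w /=; rewrite lerNl.
  rewrite set_le_preimage -[X in measurable X]setTI.
  by apply: measurableT_comp => //; apply: mW; exact: dy_ge0.
by move=> w /(_ q I l I ql); rewrite ler_norml => /andP[].
Qed.

Let partial_sum_sigma (xi : nat -> T -> R) (J : set nat) k n B :
  (forall j, (k <= j < n)%N -> J j) -> measurable B ->
  seq_sigma xi J ((fun w => \sum_(k <= j < n) xi j w) @^-1` B).
Proof.
move=> kJ mB.
suff H : measurable_fun (setT : set (g_sigma_algebraType (seq_generator xi J)))
    (fun w => \sum_(k <= j < n) xi j w).
  by rewrite -[X in seq_sigma _ _ X]setTI; exact: H.
have -> : (fun w => \sum_(k <= j < n) xi j w) =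
    (fun w => \sum_(k <= j < n) (if (k <= j < n)%N then xi j w else 0)).
  by apply/funext => w; apply: eq_big_nat => j ->.
apply: measurable_sum => j.
have [/kJ Jj|_] := boolP (k <= j < n)%N; last exact: measurable_cst.
by move=> _ C mC; rewrite setTI; exact: seq_sigma_fun.
Qed.

(* Ottaviani's inequality between a dyadic time at which [W] is large and the
   next integer time. *)
Let dyadic_max (e : R) : 0 < e -> exists x : R,
  pr P (\bigcup_q \bigcup_l [set w | x < W (dy q l) w - W 0 w]) <= e.
Proof.
move=> e0; have e2 : 0 < e / 2 by rewrite divr_gt0.
have [x hx] := skeleton e2; have [a ha] := tight.
exists (x + a).
pose H q l := [set w | x + a < W (dy q l) w - W 0 w].
have mI : measurable (\bigcup_n [set w | x < W n%:R w - W 0 w]).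
  by apply: bigcupT_measurable => n; apply: meas_gt; apply: measurable_funB; exact: mW.
have mH q l : measurable (H q l).
  by apply: meas_gt; apply: measurable_funB; apply: mW => //; exact: dy_ge0.
have mU q : measurable (\bigcup_l H q l) by exact: bigcupT_measurable.
have dyq0 q : dy q 0 = 0 :> R by rewrite /dy mul0r.
have hHq q n : pr P (hit (H q) 0 n) <= e.
  pose G l := seq_sigma (increment (dy q)) [set j | (j < l)%N].
  have := @first_hit _ _ _ P G _ _ _ (H q) (\bigcup_n [set w | x < W n%:R w - W 0 w])
    2^-1 _ mI _ n 0%N setT.
  rewrite setTI => step.
  have {}step : 2^-1 * pr P (hit (H q) 0 n) <=
      pr P (hit (H q) 0 n `&` \bigcup_n [set w | x < W n%:R w - W 0 w]).
    apply: step; last exact: (salgT (seq_sigma_algebra _ _)).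
    - by move=> l; exact: seq_sigma_algebra.
    - by move=> l A; exact: seq_sigma_measurable.
    - by move=> l; apply: seq_sigmaS => j /= /ltnW.
    - move=> l; rewrite (_ : H q l =
        (fun w => \sum_(0 <= j < l) increment (dy q) j w) @^-1` [set` `]x + a, +oo[]);
        last first.
        by apply/seteqP; split=> w /=; rewrite in_itv/= andbT sum_increment// dyq0.
      exact: partial_sum_sigma.
    - move=> l A GA AH.
      have mA := seq_sigma_measurable (fun k => mincr_dy q k) GA.
      (* The first integer strictly after the dyadic time. It is at most one unit away, so with
         probability at least 1/2 the process falls by at most [a] until then and is still above
         [x]. *)
      pose n' := (l %/ 2 ^ q).+1.
      have ln : (l <= n' * 2 ^ q)%N by rewrite ltnW// -ltn_divLR ?expn_gt0.
      have nl : dy q (n' * 2 ^ q - l) <= 1 :> R.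
        rewrite -[X in _ <= X](dyM q 1) ler_dy mul1n leq_subLR.
        rewrite /n' mulSn addnC leq_add2r; exact: leq_trunc_div.
      pose Inc :=
        (fun w => \sum_(l <= j < n' * 2 ^ q) increment (dy q) j w) @^-1` [set` `[- a, +oo[].
      have prInc : 2^-1 <= pr P Inc.
        apply: (le_trans (ha _ _ nl)).
        rewrite /pr -[X in fine X <= _](_ :
          P (W (dy q (n' * 2 ^ q - l)) @^-1` [set` `[- a, +oo[]) = _); last first.
          by congr (P _); apply/seteqP; split=> w /=; rewrite in_itv/= andbT.
        rewrite -(statW (dy_ge0 R q l) (dy_ge0 R q _))// dyD subnKC//.
        rewrite le_eqVlt; apply/orP; left; apply/eqP; congr (fine (P _)).
        by apply/seteqP; split=> w; rewrite /Inc/= sum_increment.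
      have sInc : seq_sigma (increment (dy q)) [set j | (l <= j)%N] Inc.
        by apply: partial_sum_sigma => // j /andP[].
      have mInc := seq_sigma_measurable (fun k => mincr_dy q k) sInc.
      apply: (@le_trans _ _ (pr P (A `&` Inc))).
        rewrite (independent_blocks (fun k => mincr_dy q k) (ind_dy q)
          (J := [set j | (j < l)%N]) (J' := [set j | (l <= j)%N]))//.
          by rewrite mulrC ler_wpM2l// pr_ge0.
        by move=> j /= jk; rewrite leqNgt jk.
      apply: le_pr; [exact: measurableI|exact: measurableI|].
      move=> w [Aw]; rewrite /Inc/= in_itv/= andbT sum_increment// => incw.
      split => //; exists n' => //=.
      by rewrite -(dyM q n'); have := AH w Aw; rewrite /H/=; lra.
  have mhit : measurable (hit (H q) 0 n) by exact: measurable_hit.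
  have : pr P (hit (H q) 0 n `&` \bigcup_n [set w | x < W n%:R w - W 0 w]) <= e / 2.
    by apply: le_trans hx; apply: le_pr => //; exact: measurableI.
  lra.
have hU q : pr P (\bigcup_l H q l) <= e.
  apply/ler_addgt0Pr => e' e'0.
  have UE : \bigcup_n hit (H q) 0 n = \bigcup_l H q l.
    apply/seteqP; split=> w [n _]; first by move=> [k _ Hk]; exists k.
    by move=> Hn; exists n.+1 => //; exists n => //; rewrite add0n ltnS leqnn.
  have [|n w|n] := @pr_cvg_bigcup _ _ _ P (fun n => hit (H q) 0 n) e' _ _ e'0.
  - by move=> n; exact: measurable_hit.
  - by move=> [k /andP[_ kn] Hk]; exists k => //; exact: (leq_trans kn (leqnSn n)).
  - by rewrite UE; have := hHq q n; lra.
(* Each grid is contained in the next one, so the bound for single grids passes to their union. *)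
apply/ler_addgt0Pr => e' e'0.
have [q w [l _ Hl]|q] := @pr_cvg_bigcup _ _ _ P (fun q => \bigcup_l H q l) e' mU _ e'0.
  exists (l * 2)%N => //; move: Hl; rewrite /H/=.
  by rewrite -(dyE R q 1 l) addn1 expn1.
by have := hU q; lra.
Qed.

Lemma levy_bounded_above : {ae P, forall w, exists x, forall t, 0 <= t -> W t w <= x}.
Proof.
pose U (x : nat) := \bigcup_q \bigcup_l [set w | x%:R < W (dy q l) w - W 0 w].
have mU x : measurable (U x).
  apply: bigcupT_measurable => q; apply: bigcupT_measurable => l.
  by apply: meas_gt; apply: measurable_funB; apply: mW => //; exact: dy_ge0.
have mZ : measurable (\bigcap_x U x) by exact: bigcapT_measurable.
have Z0 : pr P (\bigcap_x U x) <= 0.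
  apply/ler_addgt0Pr => e e0; rewrite add0r; have [x hx] := dyadic_max e0.
  apply: le_trans hx; apply: le_pr => //.
    apply: bigcupT_measurable => q; apply: bigcupT_measurable => l.
    by apply: meas_gt; apply: measurable_funB; apply: mW => //; exact: dy_ge0.
  move=> w /(_ (Num.truncn x).+1 I) [q _ [l _ /= h]]; exists q => //; exists l => //=.
  by apply: lt_trans h; exact: truncnS_gt.
have : {ae P, forall w, (~` \bigcap_x U x) w}.
  apply: pr1_ae; first exact: measurableC.
  by rewrite prC//; have := pr_ge0 P (\bigcap_x U x); lra.
apply: filterS3 W0 cadW => w w0 [rw _] nZ.
have [x nU] : exists x, ~ U x w.
  by apply: contrapT => h; apply: nZ => x _; apply: contrapT => nU; apply: h; exists x.
exists x%:R => t t0; rewrite -lerN2.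
have tt : t < t + 1 by rewrite ltrDl.
apply: (@right_cvg_ge_dyadic _ (fun s => - W s w) _ t (t + 1)) => //.
  by apply: cvgN; exact: rw.
move=> q l _; rewrite lerN2 leNgt; apply/negP => h; apply: nU.
by exists q => //; exists l => //=; rewrite w0 subr0.
Qed.

End levy_bounded_above.

Section levy_law_of_large_numbers.
Context d (T : measurableType d) (R : realType) (P : probability T R).
Variable X : R -> T -> R * R.
Hypothesis hX : levy_process P X.

Lemma measurable_axis i : measurable_fun setT (@axis R i).
Proof. by case: i; [exact: measurable_fst|exact: measurable_snd]. Qed.

Lemma axisB i (z z' : R * R) : axis i (z - z') = axis i z - axis i z'.
Proof. by case: i. Qed.

Section tilted.
Variables (i : bool) (sg c : R).

Let W (t : R) (w : T) : R := sg * axis i (X t w) - c * t.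

Let tilt (h : R) (z : R * R) : R := sg * axis i z - c * h.

Let measurable_tilt h : measurable_fun setT (tilt h).
Proof.
apply: measurable_funB; last exact: measurable_cst.
by apply: measurable_funM; [exact: measurable_cst|exact: measurable_axis].
Qed.

Let mtilt h B : measurable B -> measurable [set z | B (tilt h z)].
Proof. by move=> mB; rewrite -[X in measurable X]setTI; exact: measurable_tilt. Qed.

Let incE s t w : W t w - W s w = tilt (t - s) (X t w - X s w).
Proof. by rewrite /W /tilt axisB !mulrBr; lra. Qed.

(** Subtracting a line steeper than the mean leaves stationary independent increments with negative
    drift. The choices 1 and -1 of [sg] give the upper and the lower half of the law of large
    numbers. *)
Lemma tilted_bounded_above :
  P.-integrable setT (fun w => (axis i (X 1 w))%:E) ->
  sg * (\int[P]_w axis i (X 1 w)) < c ->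
  {ae P, forall w, exists x, forall t, 0 <= t -> sg * axis i (X t w) - c * t <= x}.
Proof.
move=> intX driftX.
have mW t : 0 <= t -> measurable_fun setT (W t).
  move=> t0; rewrite (_ : W t = tilt t \o X t)//.
  by apply: measurableT_comp; [exact: measurable_tilt|exact: (levy_measurable hX)].
have intS : P.-integrable setT (EFin \o (fun w => sg * axis i (X 1 w))).
  exact: (integrableZl measurableT sg intX).
apply: (@levy_bounded_above _ _ _ P W mW).
- apply: filterS (levy_0 hX) => w w0; rewrite /W w0 mulr0 subr0.
  by case: (i); rewrite mulr0.
- move=> t t0 tt n B mB.
  pose C (k : nat) := [set z | B k (tilt (t k.+1 - t k) z)].
  have := levy_independent hX t0 tt (B := fun k : 'I_n => C k).
  move=> /(_ (fun k => mtilt _ (mB k))) h.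
  rewrite /pr (_ : box _ B n =
      [set w | forall k : 'I_n, C k (X (t k.+1) w - X (t k) w)]); last first.
    apply/seteqP; split=> w /= H k; first by rewrite /C/= -incE; exact: H.
    by move=> kn; have := H (Ordinal kn); rewrite /C/= -incE.
  have mt k : 0 <= t k by elim: k => // k IH; rewrite (le_trans IH).
  rewrite h -[RHS]/(fine (\prod_(k < n) pr P (increment W t k @^-1` B k))%:E).
  congr fine; rewrite -prodEFin; apply: eq_bigr => k _.
  rewrite -prE.
    by congr (P _); apply/seteqP; split=> w /=; rewrite /increment incE.
  rewrite -[X in measurable X]setTI; apply: measurable_funB => //; exact: mW.
- move=> s h s0 h0 B mB.
  rewrite -[RHS](_ : P [set w | [set z | B (tilt h z)] (X h w)] = _)//.
  rewrite -(levy_stationary hX s0 h0); last exact: mtilt.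
  congr (P _); apply/seteqP; split=> w /=; rewrite incE (_ : s + h - s = h)//; lra.
- apply: filterS (levy_cadlag hX) => w cw.
  have [ra la] := cadlag_coord i cw.
  split=> t t0.
    apply: cvgB; first by apply: cvgMr; exact: ra.
    apply: cvgMr; apply: cvg_within_filter; exact: cvg_id.
  have [l xl] := la t t0; exists (sg * l - c * t).
  apply: cvgB; first by apply: cvgMr; exact: xl.
  by apply: cvgMr; apply: cvg_within_filter; exact: cvg_id.
- have := integrable_add intS (integrable_cst_prob P (- (c * 1))).
  by [].
- rewrite /W RintegralB//; last exact: integrable_cst_prob.
  rewrite RintegralZl// Rintegral_cst// -/(pr P setT) prT !mulr1; lra.
Qed.

End tilted.

Lemma levy_law_of_large_numbers i (m : R) :
  P.-integrable setT (fun w => (axis i (X 1 w))%:E) ->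
  \int[P]_w axis i (X 1 w) = m ->
  {ae P, forall w e, 0 < e -> exists C, near_line C e m (fun t => axis i (X t w))}.
Proof.
move=> intX Em.
(* Slopes [m + 1 / (n + 1)] form a countable family, so a single null set serves every [e]. *)
have up : {ae P, forall w (n : nat), exists x, forall t, 0 <= t ->
    1 * axis i (X t w) - (m + n.+1%:R^-1) * t <= x}.
  apply: ae_foralln => n; apply: tilted_bounded_above => //.
  by rewrite Em mul1r ltrDl invr_gt0.
have dn : {ae P, forall w (n : nat), exists x, forall t, 0 <= t ->
    -1 * axis i (X t w) - (- m + n.+1%:R^-1) * t <= x}.
  apply: ae_foralln => n; apply: tilted_bounded_above => //.
  by rewrite Em mulN1r ltrDl invr_gt0.
apply: filterS2 up dn => w hu hd e e0.
pose n := Num.truncn e^-1.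
have ne : n.+1%:R^-1 <= e.
  by rewrite -[leRHS]invrK lef_pV2 ?posrE ?invr_gt0// ltW// truncnS_gt.
have [x Hx] := hu n; have [y Hy] := hd n.
exists (Num.max x y) => t t0.
have := Hx t t0; have := Hy t t0; have := ler_wpM2r t0 ne.
have : x <= Num.max x y by rewrite le_max lexx.
have : y <= Num.max x y by rewrite le_max lexx orbT.
rewrite ler_norml; move: (Num.max x y) => M.
move: (n.+1%:R^-1) => q; lra.
Qed.

End levy_law_of_large_numbers.

(** * Domination probabilities *)

Section path_events.
Variable R : realType.

Lemma near_line_dyadic (C e m : R) (f : R -> R) :
  (forall t : R, 0 <= t -> f s @[s --> t^'+] --> f t) ->
  (forall q l, `|f (dy q l) - m * dy q l| <= e * dy q l + C) -> near_line C e m f.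
Proof.
move=> rf H t t0; rewrite -subr_ge0.
have tt : t < t + 1 by rewrite ltrDl.
have cid : (fun s : R => s) s @[s --> t^'+] --> t.
  by apply: cvg_within_filter; exact: cvg_id.
apply: (@right_cvg_ge_dyadic _ (fun s => e * s + C - `|f s - m * s|) 0 t _ t0 tt).
  apply: cvgB; first by apply: cvgD; [exact: cvgMr|exact: cvg_cst].
  by apply: cvg_norm; apply: cvgB; [exact: rf|exact: cvgMr].
by move=> q l _; rewrite subr_ge0.
Qed.

Lemma path_measurable_coord (t : R) (B : set (R * R)) : 0 <= t -> measurable B ->
  path_measurable [set y | B (y t)].
Proof. by move=> t0 mB; apply: sub_sigma_algebra; exists t, B. Qed.

Lemma measurable_axis_ge (c : R) i : measurable [set z : R * R | c <= axis i z].
Proof.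
rewrite (_ : [set _ | _] = @axis R i @^-1` [set` `[c, +oo[]); last first.
  by apply/seteqP; split=> z /=; rewrite in_itv/= andbT.
by rewrite -[X in measurable X]setTI; exact: measurable_axis.
Qed.

Lemma measurable_axis_le (c : R) i : measurable [set z : R * R | axis i z <= c].
Proof.
by rewrite set_le_preimage -[X in measurable X]setTI; exact: measurable_axis.
Qed.

Lemma measurable_axis_lt (c : R) i : measurable [set z : R * R | axis i z < c].
Proof.
rewrite (_ : [set _ | _] = ~` [set z : R * R | c <= axis i z]).
  by apply: measurableC; exact: measurable_axis_ge.
by apply/seteqP; split=> z /=; rewrite ltNge => /negP.
Qed.

Lemma measurable_quadrant : measurable (@quadrant R).
Proof.
apply: measurableI; first exact: (measurable_axis_ge 0 true).
exact: (measurable_axis_ge 0 false).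
Qed.

Lemma path_measurable_dominates i : path_measurable (@dyadic_dominates R i).
Proof.
have sP := smallest_sigma_algebra setT [set D | exists (t : R) (B : set (R * R)),
  [/\ 0 <= t, measurable B & D = [set y | B (y t)]]].
pose B (n : nat) := [set z : R * R | n%:R <= axis i z /\ n%:R * axis (~~ i) z <= axis i z].
have mB n : measurable (B n).
  rewrite (_ : B n = [set z : R * R | n%:R <= axis i z] `&`
      (fun z : R * R => axis i z - n%:R * axis (~~ i) z) @^-1` [set` `[0, +oo[]); last first.
    by apply/seteqP; split=> z /=; rewrite in_itv/= andbT subr_ge0.
  apply: measurableI; first exact: measurable_axis_ge.
  rewrite -[X in measurable X]setTI; apply: measurable_funB => //; first exact: measurable_axis.
  by apply: measurable_funM; [exact: measurable_cst|exact: measurable_axis].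
rewrite (_ : dyadic_dominates i = \bigcap_n \bigcup_N \bigcap_m \bigcap_k
    [set y | (N%:R : R) <= dy m k -> B n (y (dy m k))]).
  apply: (salg_bigcap sP) => n; apply: (salg_bigcup sP) => N.
  apply: (salg_bigcap sP) => m; apply: (salg_bigcap sP) => k.
  apply: (salg_imp sP (B := [set y : R -> R * R | B n (y (dy m k))])) => _.
  by apply: path_measurable_coord => //; exact: dy_ge0.
apply/seteqP; split=> y H n.
  by move=> _; have [N HN] := H n; exists N => // m _ k _ /=; exact: HN.
by have [N _ HN] := H n I; exists N => m k; exact: (HN m I k I).
Qed.

End path_events.

Section reflected_family.
Context (R : realType) (d : measure_display) (T : measurableType d).
Variables (P : probability T R) (F : R -> set (set T)) (X : R -> T -> R * R).
Variables (r1 r2 : R) (Y L : R * R -> R -> T -> R * R) (mu : R * R).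
Hypothesis hF : filtration F.
Hypothesis hX : levy_process P X.
Hypothesis hXF : adapted F X.
Hypotheses (hr1 : 0 < r1) (hr2 : 0 < r2).
Hypothesis hY : reflected_family P F r1 r2 X Y L.
Hypothesis mu_lt0 : forall i, axis i mu < 0.
Hypothesis intX : forall i, P.-integrable setT (fun w => (axis i (X 1 w))%:E).
Hypothesis drift : forall i, 0 < axis i mu - rho r1 r2 i * axis (~~ i) mu.
Hypothesis EX : forall i, \int[P]_w axis i (X 1 w) = axis i mu.

Definition good_path (z : R * R) (w : T) : Prop :=
  [/\ reflected_path r1 r2 z (X ^~ w) (Y z ^~ w) (L z ^~ w), X 0 w = 0,
      cadlag (X ^~ w) &
      forall i e, 0 < e -> exists C, near_line C e (axis i mu) (fun t => axis i (X t w))].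

Lemma good_path_ae z : quadrant z -> {ae P, forall w, good_path z w}.
Proof.
move=> qz.
have h1 := levy_law_of_large_numbers hX (intX true) (EX true).
have h2 := levy_law_of_large_numbers hX (intX false) (EX false).
have h3 := family_reflected hY qz.
have h4 := levy_0 hX; have h5 := levy_cadlag hX.
apply: filterS2 (filterI h1 h2) (filterI h3 (filterI h4 h5)) => w [a1 a2] [a3 [a4 a5]].
by split=> // -[].
Qed.

Lemma quadrantP (z : R * R) : quadrant z <-> forall i, 0 <= axis i z.
Proof.
by split=> [[h1 h2] []//|h]; split; [exact: (h true)|exact: (h false)].
Qed.

(** [S] is general because two choices occur: [measurable], and the sigma-algebra generated by the
    [F n] that [zero_one] asks for. *)
Lemma path_event (S : set (set T)) (z : R * R) (D : set (R -> R * R)) :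
  sigma_algebra setT S -> (forall t, 0 <= t -> F t `<=` S) -> quadrant z ->
  path_measurable D -> S [set w | D (Y z ^~ w)].
Proof.
move=> sS FS qz mD; apply: (mD [set D' | S [set w | D' (Y z ^~ w)]]); split => /=.
- split; first by case: sS => + _ _; congr S; apply/seteqP; split.
  + move=> D' SD; have := salgC sS SD; congr S.
    by apply/seteqP; split=> w /=; tauto.
  + by move=> D' SD; exact: (salg_bigcup sS SD).
- by move=> _ [t [B [t0 mB ->]]]; apply: (FS t t0); exact: (family_adaptedY hY qz).
Qed.

Lemma measurable_path_event z D : quadrant z -> path_measurable D ->
  measurable [set w | D (Y z ^~ w)].
Proof.
apply: path_event; first exact: sigma_algebra_measurable.
exact: (filtration_sub hF).
Qed.

Definition domination_event i z := [set w | dyadic_dominates i (Y z ^~ w)].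

Lemma measurable_domination_event i z : quadrant z -> measurable (domination_event i z).
Proof. by move=> qz; apply: measurable_path_event => //; exact: path_measurable_dominates. Qed.

Lemma mu_ext_domination i z : quadrant z ->
  mu_ext P [set w | dominates i (Y z ^~ w)] = (pr P (domination_event i z))%:E.
Proof.
move=> qz; apply: mu_ext_ae; first exact: measurable_domination_event.
apply: filterS (good_path_ae qz) => w [h _ cx _]; apply: dominatesE.
  exact: reflected_nonneg h.
exact: reflected_right_continuous h cx.
Qed.

Lemma domination_disjoint z : quadrant z ->
  pr P (domination_event true z `|` domination_event false z) =
  pr P (domination_event true z) + pr P (domination_event false z).
Proof.
move=> qz.
have mt := measurable_domination_event true qz.
have mf := measurable_domination_event false qz.
have mtC := measurableC mt.
have mU := measurableU _ _ mt mf.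
rewrite (@prID _ _ _ P _ _ mU mt) setUK; congr (_ + _).
apply/eqP; rewrite eq_le; apply/andP; split.
  apply: le_pr => //; first exact: measurableI.
  by move=> w [[]].
apply: pr_ae_le => //; first exact: measurableI.
apply: filterS (good_path_ae qz) => w [h _ _ _] wf; split; first by right.
by move=> wt; exact: (dominates_disjoint (reflected_nonneg h) wt wf).
Qed.

(** The Markov property at a constant time, with the conditional probability replaced by a lower
    bound valid on [S]. The assumption on shifts turns [D] for the restarted path into [D] for the
    whole path. *)
Lemma markov_lower z m k (A : set T) (S : set (R * R)) D (p : R) :
  quadrant z -> F (dy m k) A -> A `<=` [set w | S (Y z (dy m k) w)] ->
  S `<=` @quadrant R -> path_measurable D ->
  (forall y, D (fun t => y (dy m k + t)) -> D y) -> 0 <= p ->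
  (forall z', S z' -> p <= pr P [set w | D (Y z' ^~ w)]) ->
  p * pr P A <= pr P (A `&` [set w | D (Y z ^~ w)]).
Proof.
move=> qz FA AS Sq mD shift p0 Hp.
have s0 : 0 <= dy m k :> R by exact: dy_ge0.
have mA : measurable A by exact: (filtration_sub hF s0).
have cst_le (t : R) : [set w : T | dy m k <= t] = setT \/ [set w : T | dy m k <= t] = set0.
  have [le|nle] := boolP (dy m k <= t); [left|right]; first by apply/seteqP; split.
  by apply/seteqP; split=> w //=; rewrite (negbTE nle).
have st : stopping_time F (fun=> dy m k).
  split=> // t t0; have sF := filtration_sigma hF t0.
  by case: (cst_le t) => ->; [exact: salgT|case: sF].
have sA : stopped_sigma F (fun=> dy m k) A.
  split => // t t0; have [le|nle] := boolP (dy m k <= t).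
    by have := filtration_mono hF s0 le FA; congr (F t); apply/seteqP; split=> w // [].
  case: (filtration_sigma hF t0) => + _ _; congr (F t).
  by apply/seteqP; split=> w // [].
have mE := measurable_path_event qz mD.
rewrite -lee_fin EFinM -!prE//; last exact: measurableI.
rewrite -[leRHS]measurable_mu_extE; last exact: measurableI.
apply: (@le_trans _ _ (mu_ext P (A `&` [set w | D (fun t => Y z (dy m k + t) w)]))); last first.
  by apply: le_mu_ext => w [Aw Dw]; split => //; exact: (shift (fun t => Y z t w)).
rewrite (markov_property (family_markov hY) qz st sA mD).
apply: integral_ge_measure => // w Aw.
have Sw := AS w Aw.
rewrite /path_law prE ?lee_fin; first exact: Hp.
exact: (measurable_path_event (Sq _ Sw) mD).
Qed.

Let X_right (w : T) i : cadlag (X ^~ w) -> forall t : R, 0 <= t ->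
  axis i (X s w) @[s --> t^'+] --> axis i (X t w).
Proof. by move=> cx t t0; exact: (right_continuous_coord cx t0). Qed.

Let measurable_axisX i t : 0 <= t -> measurable_fun setT (fun w => axis i (X t w)).
Proof.
by move=> t0; have := measurableT_comp (measurable_axis i) (levy_measurable hX t0).
Qed.

(** The event [G C] concerns [X] alone, so a single [C] that makes it likely serves all starts; [K]
    is then what the pathwise escape demands. *)
Lemma domination_far i (eta : R) : 0 < eta -> exists2 K, 0 <= K &
  forall z, quadrant z -> K + rho r1 r2 i * axis (~~ i) z <= axis i z ->
  1 - eta <= pr P (domination_event i z).
Proof.
move=> eta0.
have rho0 := rho_gt0 hr1 hr2 i.
(* The errors [e] in both coordinates cost [e * (1 + rho)] of the rate, which is half of the gap
   provided by (A2). *)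
pose e := (axis i mu - rho r1 r2 i * axis (~~ i) mu) / (2 * (1 + rho r1 r2 i)).
have q0 : 0 < 2 * (1 + rho r1 r2 i) by rewrite mulr_gt0// addr_gt0.
have e0 : 0 < e by rewrite divr_gt0.
have eE : e * (2 * (1 + rho r1 r2 i)) = axis i mu - rho r1 r2 i * axis (~~ i) mu.
  by rewrite divfK// gt_eqF.
have dr : 0 < axis i mu - e + rho r1 r2 i * (- axis (~~ i) mu - e).
  by have := drift i; rewrite -eE; lra.
pose near_at k (C : nat) q l := [set w |
  `|axis k (X (dy q l) w) - axis k mu * dy q l| <= e * dy q l + C%:R].
have mnear k C q l : measurable (near_at k C q l).
  rewrite /near_at set_le_preimage -[X in measurable X]setTI.
  apply: measurableT_comp => //; apply: measurable_funB => //.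
  by apply: measurable_axisX; exact: dy_ge0.
pose G C := \bigcap_q \bigcap_l (near_at true C q l `&` near_at false C q l).
have mG C : measurable (G C).
  apply: bigcapT_measurable => q; apply: bigcapT_measurable => l.
  exact: measurableI.
have U1 : pr P (\bigcup_C G C) = 1.
  apply: pr_ae1; first exact: bigcupT_measurable.
  have qz0 : quadrant (0 : R * R) by split; rewrite /= lexx.
  apply: filterS (good_path_ae qz0) => w [_ _ _ lln].
  have [C1 HC1] := lln true e e0; have [C2 HC2] := lln false e e0.
  pose C := (Num.truncn (Num.max C1 C2)).+1.
  have : Num.max C1 C2 <= C%:R by rewrite ltW// truncnS_gt.
  rewrite ge_max => /andP[C1C C2C].
  exists C => // q _ l _; split; rewrite /near_at/=.
    by apply: le_trans (HC1 _ (dy_ge0 _ _ _)) _; rewrite lerD2l.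
  by apply: le_trans (HC2 _ (dy_ge0 _ _ _)) _; rewrite lerD2l.
have [C w H q _ l _|C hC] := @pr_cvg_bigcup _ _ _ P G eta mG _ eta0.
  have [h1 h2] := H q I l I; split; rewrite /near_at/=.
    by apply: le_trans h1 _; rewrite lerD2l ler_nat.
  by apply: le_trans h2 _; rewrite lerD2l ler_nat.
exists (C%:R * (1 + rho r1 r2 i) + 1).
  by rewrite addr_ge0// mulr_ge0// addr_ge0// ltW.
move=> z qz far.
rewrite U1 in hC; apply: le_trans (ltW hC) _.
apply: pr_ae_le => //; first exact: measurable_domination_event.
apply: filterS (good_path_ae qz) => w [h x0 cx lln] Gw.
have xC k : near_line C%:R e (axis k mu) (fun t => axis k (X t w)).
  apply: near_line_dyadic => [|q l]; first exact: X_right.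
  by have [h1 h2] := Gw q I l I; case: k.
exact: (escape_dominates hr1 hr2 h ((quadrantP z).1 qz) mu_lt0 e0 dr xC far (lln _)).
Qed.

(** * Uniform lower bounds from the event of (A3) *)

Section rise.
Variable i : bool.
Hypothesis up : (0 < mu_ext P (up_at_infimum (fun t w => axis i (X t w))
                                 (fun t w => axis (~~ i) (X t w))))%E.

(* The event of (A3) read at a dyadic time, at which coordinate [~~ i] is within
   [eta] of its running infimum. *)
Let rise_event (a eta D : R) m k : set T :=
  [set w | a <= axis i (X (dy m k) w)] `&`
  \bigcap_q \bigcap_l [set w | dy q l <= dy m k :> R ->
     axis (~~ i) (X (dy m k) w) <= axis (~~ i) (X (dy q l) w) + eta /\
     - D <= axis i (X (dy q l) w)].

Let F_axis_le j s (c : R) t : 0 <= s -> s <= t -> F t [set w | c <= axis j (X s w)].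
Proof.
move=> s0 st; apply: (filtration_mono hF s0 st).
exact: (hXF s0 (measurable_axis_ge c j)).
Qed.

Let F_rise a eta D m k : F (dy m k) (rise_event a eta D m k).
Proof.
have s0 := dy_ge0 R m k; have sF := filtration_sigma hF s0.
apply: (salgI sF); first exact: F_axis_le.
apply: (salg_bigcap sF) => q; apply: (salg_bigcap sF) => l.
pose j := ~~ i.
apply: (salg_imp sF (B := [set w | axis j (X (dy m k) w) <= axis j (X (dy q l) w) + eta /\
     - D <= axis i (X (dy q l) w)])) => qm.
apply: (salgI sF (A := [set w | axis j (X (dy m k) w) <= axis j (X (dy q l) w) + eta])
   (B := [set w | - D <= axis i (X (dy q l) w)])); last first.
  by apply: F_axis_le => //; exact: dy_ge0.
pose gT := g_sigma_algebraType (F (dy m k)).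
have gE : @measurable _ gT = F (dy m k).
  by apply: sigma_algebra_id.
have mX s : 0 <= s -> s <= dy m k -> measurable_fun (setT : set gT) (fun w => axis j (X s w)).
  move=> s0' sm; apply: (measurableT_comp (measurable_axis j)) => _ B mB.
  by rewrite setTI gE; apply: (filtration_mono hF s0' sm); exact: hXF.
have : measurable_fun (setT : set gT)
    (fun w => axis j (X (dy m k) w) - axis j (X (dy q l) w)).
  by apply: measurable_funB; apply: mX => //; exact: dy_ge0.
move=> /(_ measurableT [set` `]-oo, eta]] (measurable_itv _)).
rewrite setTI gE; congr (F _); apply/seteqP; split=> w /=; rewrite in_itv/= lerBlDl//.
Qed.

Let measurable_rise a eta D m k : measurable (rise_event a eta D m k).
Proof. by apply: (filtration_sub hF (dy_ge0 R m k)); exact: F_rise. Qed.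

(* Small enough for the gain [a] of coordinate [i] to outweigh [rho i * eta]. *)
Let eta_of (a : R) : R := a / (2 * rho r1 r2 i).

(** Rise events with countably many parameters cover the event of (A3) up to a null set, so they
    cannot all be null. Right-continuity moves a time of (A3) to a dyadic time just after it; the
    tolerance [eta] pays for the move. *)
Lemma exists_rise : exists a D m k,
  [/\ 0 < a, 0 <= D & 0 < pr P (rise_event a (eta_of a) D m k)].
Proof.
apply: contrapT => H.
have rho0 := rho_gt0 hr1 hr2 i.
pose ev (p D m k : nat) := rise_event p.+1%:R^-1 (eta_of p.+1%:R^-1) D%:R m k.
have ev0 p D m k : {ae P, forall w, ~ ev p D m k w}.
  have mev : measurable (ev p D m k) by exact: measurable_rise.
  apply: (pr1_ae (A := ~` ev p D m k)); first exact: measurableC.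
  rewrite prC//; have := pr_ge0 P (ev p D m k); rewrite le_eqVlt => /orP[/eqP <-|pos].
    by rewrite subr0.
  exfalso; apply: H; exists p.+1%:R^-1, D%:R, m, k; split => //.
have {}ev0 : {ae P, forall w p D m k, ~ ev p D m k w}.
  by do 4! apply: ae_foralln => ?; exact: ev0.
have qz0 : quadrant (0 : R * R) by split; rewrite /= lexx.
have : (mu_ext P (up_at_infimum (fun t w => axis i (X t w))
        (fun t w => axis (~~ i) (X t w))) <= mu_ext P set0)%E.
  apply: mu_ext_ae_le; apply: filterS2 ev0 (good_path_ae qz0) => w nev [_ x0 cx _].
  move=> [t [t0 xt xinf]]; have t0' := ltW t0.
  pose p := Num.truncn (axis i (X t w))^-1.
  pose a : R := p.+1%:R^-1.
  have a0 : 0 < a by rewrite invr_gt0.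
  have axt : a < axis i (X t w).
    by rewrite -[ltRHS]invrK ltf_pV2 ?posrE ?invr_gt0// truncnS_gt.
  pose eta := eta_of a.
  have eta0 : 0 < eta by rewrite divr_gt0// mulr_gt0.
  have [C1 HC1] := cadlag_bounded (cadlag_coord (~~ i) cx) t0'.
  (* [inf] is a lower bound only for sets that are bounded below, which the constant [C1]
     ensures. *)
  have xle s : 0 <= s <= t -> axis (~~ i) (X t w) <= axis (~~ i) (X s w).
    move=> st; rewrite xinf; apply: ge_inf; last first.
      by exists s => //=; rewrite in_itv/=.
    exists (- C1%:R) => _ [u /= + <-]; rewrite in_itv/= => ut.
    by have := HC1 u ut; rewrite ler_norml => /andP[].
  have h1 : \forall s \near t^'+, a < axis i (X s w).
    by apply: (cvgr_gt (axis i (X t w))) => //; exact: X_right.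
  (* Half of [eta], because a time between [t] and the dyadic time is compared with the latter
     through the value at [t]. *)
  have h2 : \forall s \near t^'+, `|axis (~~ i) (X t w) - axis (~~ i) (X s w)| < eta / 2.
    by move: (@X_right w (~~ i) cx t t0') => /cvgrPdist_lt; apply; rewrite divr_gt0.
  have [b /= b0 Hb] := filterI h1 h2.
  have [|m [k /andP[tm mb]]] := @dyadic_between R t (t + b) t0'; first by rewrite ltrDl.
  have near_t s : t < s -> s <= dy m k -> a < axis i (X s w) /\
      `|axis (~~ i) (X t w) - axis (~~ i) (X s w)| < eta / 2.
    move=> ts sm; apply: Hb => //=.
    by rewrite ltr0_norm ?subr_lt0// opprB; move: (dy m k) tm mb sm => ?; lra.
  have [D HD] := cadlag_bounded (cadlag_coord i cx) (dy_ge0 R m k).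
  have [a1 a2] := near_t _ tm (lexx _).
  apply: (nev p D m k); split; first exact: ltW.
  move=> q _ l _ /= ql; split; last first.
    by have := HD (dy q l); rewrite dy_ge0 ql => /(_ isT); rewrite ler_norml => /andP[].
  rewrite -/a -/eta.
  have [qt|tq] := leP (dy q l) t.
    have := xle (dy q l); rewrite dy_ge0 qt => /(_ isT).
    move: a2; rewrite ltr_norml; lra.
  have [_] := near_t _ tq ql.
  move: a2; rewrite !ltr_norml; lra.
by rewrite mu_ext0// leNgt up.
Qed.

(** The property is propagated backwards, from a region far out to the regions from which a rise
    leads there. *)
Let reach (A V : R) := exists2 p, 0 < p & forall z, quadrant z ->
  A <= axis i z -> axis (~~ i) z <= V -> p <= pr P (domination_event i z).

Let reach_step (a D : R) m k A V b : 0 < a -> 0 <= D -> 0 <= A ->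
  0 < pr P (rise_event a (eta_of a) D m k) ->
  rho r1 r2 (~~ i) * Num.max 0 (D - A) <= b ->
  reach (A + a) (V + eta_of a + b) -> reach A V.
Proof.
move=> a0 D0 A0 prB hb [p p0 Hp].
have rho0 := rho_gt0 hr1 hr2 i; have rhoj0 := rho_gt0 hr1 hr2 (~~ i).
have eta0 : 0 <= eta_of a by rewrite divr_ge0 ?mulr_ge0// ltW.
set B := rise_event _ _ _ _ _ in prB.
exists (p * pr P B); first exact: mulr_gt0.
move=> z qz Az zV.
pose S := [set z' : R * R | quadrant z' /\ (A + a <= axis i z' /\
   axis (~~ i) z' <= V + eta_of a + b)].
have mS : measurable S.
  apply: measurableI; first exact: measurable_quadrant.
  by apply: measurableI; [exact: measurable_axis_ge|exact: measurable_axis_le].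
have s0 := dy_ge0 R m k; have sF := filtration_sigma hF s0.
pose BS := B `&` [set w | S (Y z (dy m k) w)].
have FBS : F (dy m k) BS.
  apply: (salgI sF); first exact: F_rise.
  exact: (family_adaptedY hY qz s0 mS).
have mBS : measurable BS by exact: (filtration_sub hF s0).
have BBS : pr P B <= pr P BS.
  apply: pr_ae_le => //; first exact: measurable_rise.
  apply: filterS (good_path_ae qz) => w [h x0 cx _] [xa Bw]; split => //.
  have xj t : 0 <= t <= dy m k ->
      axis (~~ i) (X (dy m k) w) <= axis (~~ i) (X t w) + eta_of a /\
      - D <= axis i (X t w).
    move=> /andP[t0]; rewrite le_eqVlt => /orP[/eqP ->|tm].
      by have := Bw m I k I (lexx _).
    split.
      rewrite -lerBlDr; apply: (right_cvg_ge_dyadic t0 tm (X_right cx t0)).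
      move=> q l /andP[_ /ltW qm]; rewrite lerBlDr.
      by have [] := Bw q I l I qm.
    apply: (right_cvg_ge_dyadic t0 tm (X_right cx t0)).
    move=> q l /andP[_ /ltW qm].
    by have [] := Bw q I l I qm.
  have [] := reflected_cycle hr1 hr2 (i := i) (D := D) h ((quadrantP z).1 qz) cx x0 s0 eta0 xa
    (fun t ht => (xj t ht).1) (fun t ht => (xj t ht).2).
  move=> yi yj; split; first by have [? ?] := reflected_ge0 h s0.
  split; first lra.
  apply: (le_trans yj).
  have : rho r1 r2 (~~ i) * Num.max 0 (D - axis i z) <= b.
    apply: le_trans hb; rewrite ler_pM2l//.
    rewrite ge_max le_max lexx/= le_max; apply/orP; right; lra.
  lra.
apply: (@le_trans _ _ (p * pr P BS)); first by rewrite ler_pM2l.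
apply: (@le_trans _ _ (pr P (BS `&` domination_event i z))).
  apply: (markov_lower qz FBS (S := S)) => //.
  - by move=> w [].
  - by move=> z' [].
  - exact: path_measurable_dominates.
  - by move=> y; exact: (@dyadic_dominates_shift R i y m k).
  - exact: ltW.
  - by move=> z' [qz' [h1 h2]]; exact: Hp.
apply: le_pr => //.
- by apply: measurableI => //; exact: measurable_domination_event.
- exact: measurable_domination_event.
Qed.

(** Rises come in two phases. Until coordinate [i] reaches [D], each may cost the other coordinate
    [eta + rho D], with [rho] taken at [~~ i], but boundedly many suffice. Afterwards each costs
    only [eta] and gains [a - rho i * eta = a / 2] on the condition of [domination_far]. The number
    of rises does not depend on the start. *)
Lemma domination_lower V : exists2 p, 0 < p & forall z, quadrant z ->
  axis (~~ i) z <= V -> p <= pr P (domination_event i z).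
Proof.
have [a [D [m [k [a0 D0 prB]]]]] := exists_rise.
have rho0 := rho_gt0 hr1 hr2 i; have rhoj0 := rho_gt0 hr1 hr2 (~~ i).
have half0 : (0 : R) < 2^-1 by rewrite invr_gt0.
have [K K0 HK] := domination_far i half0.
have etaE : rho r1 r2 i * eta_of a = a / 2.
  by rewrite /eta_of; field; rewrite gt_eqF.
have nat_ge (c : R) : exists n : nat, c <= n%:R * a.
  exists (Num.truncn (c / a)).+1; rewrite -ler_pdivrMr//.
  by rewrite ltW// truncnS_gt.
have steps b A' V' n : 0 <= A' -> 
    (forall A'', A' <= A'' -> rho r1 r2 (~~ i) * Num.max 0 (D - A'') <= b) ->
    reach (A' + n%:R * a) (V' + n%:R * (eta_of a + b)) -> reach A' V'.
  elim: n A' V' => [|n IH] A' V' A'0 hb; first by rewrite !mul0r !addr0.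
  move=> H; apply: (reach_step a0 D0 A'0 prB (hb _ (lexx _))).
  apply: IH; first by rewrite addr_ge0// ltW.
    by move=> A'' h; apply: hb; apply: le_trans h; rewrite lerDl ltW.
  move: H; rewrite -natr1 !mulrDl !mul1r.
  rewrite (_ : A' + (n%:R * a + a) = A' + a + n%:R * a); last lra.
  by rewrite (_ : V' + (n%:R * (eta_of a + b) + (eta_of a + b)) =
    V' + eta_of a + b + n%:R * (eta_of a + b)); last lra.
have high A' V' : D <= A' -> reach A' V'.
  move=> DA.
  (* The net gain [n * a / 2] has to cover [K + rho i * V']. *)
  have [n hn] := nat_ge (2 * (K + rho r1 r2 i * V')).
  apply: (steps 0 A' V' n).
  - exact: le_trans DA.
  - move=> A'' AA; rewrite max_l ?mulr0//; lra.
  - exists 2^-1 => // z qz zi zj; apply: le_trans (HK z qz _).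
      by lra.
    have := ler_wpM2l (ltW rho0) zj.
    have : rho r1 r2 i * (n%:R * (eta_of a + 0)) = n%:R * (a / 2).
      by rewrite addr0 mulrCA etaE.
    lra.
have [n hn] := nat_ge D.
have [p p0 Hp] : reach 0 V.
  apply: (steps (rho r1 r2 (~~ i) * D) 0 V n (lexx _)).
    move=> A'' A0; rewrite ler_pM2l// ge_max D0/=; lra.
  by apply: high; rewrite add0r.
by exists p => // z qz zj; apply: Hp => //; exact: ((quadrantP z).1 qz i).
Qed.

End rise.

Hypothesis up : forall i, (0 < mu_ext P (up_at_infimum (fun t w => axis i (X t w))
                                 (fun t w => axis (~~ i) (X t w))))%E.

Lemma domination_total z : quadrant z ->
  pr P (domination_event true z) + pr P (domination_event false z) = 1.
Proof.
move=> qz; rewrite -domination_disjoint//.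
pose D (y : R -> R * R) := dyadic_dominates true y \/ dyadic_dominates false y.
have mD : path_measurable D.
  apply: (salgU (smallest_sigma_algebra _ _)); exact: path_measurable_dominates.
have Dshift m k (y : R -> R * R) : D (fun t => y (dy m k + t)) -> D y.
  by move=> [h|h]; [left|right]; exact: (@dyadic_dominates_shift R _ y m k).
have [p1 p10 Hp1] := domination_lower (up true) 1.
have [p2 p20 Hp2] := domination_lower (up false) 1.
pose p := Num.min p1 p2.
have p0 : 0 < p by rewrite lt_min p10.
pose S := [set z' : R * R | quadrant z' /\ (axis true z' < 1 \/ axis false z' < 1)].
have mS : measurable S.
  apply: measurableI; first exact: measurable_quadrant.
  by apply: measurableU; exact: measurable_axis_lt.
have mE z' : quadrant z' -> measurable [set w | D (Y z' ^~ w)].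
  by move=> qz'; exact: measurable_path_event.
(* When one coordinate is below 1, the bound is for domination by the other one. *)
have SD z' : S z' -> p <= pr P [set w | D (Y z' ^~ w)].
  move=> [qz' [h|h]].
    apply: (@le_trans _ _ (pr P (domination_event false z'))).
      by rewrite ge_min Hp2 ?orbT// ltW.
    apply: le_pr; [exact: measurable_domination_event|exact: mE|by move=> w; right].
  apply: (@le_trans _ _ (pr P (domination_event true z'))).
    by rewrite ge_min Hp1// ltW.
  apply: le_pr; [exact: measurable_domination_event|exact: mE|by move=> w; left].
pose E := [set w | D (Y z ^~ w)].
have mEz : measurable E by exact: mE.
have nat0 (n : nat) : (0 : R) <= n%:R by [].
apply: (@zero_one _ _ _ P (fun n : nat => F n%:R) _ _ _ E p _ p0) => //.
- by move=> n; exact: filtration_sigma.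
- by move=> n A; exact: filtration_sub.
- by move=> n; apply: (filtration_mono hF) => //; rewrite ler_nat.
- apply: (path_event (smallest_sigma_algebra _ _) _ qz mD) => t t0 A FA.
  apply: sub_sigma_algebra; exists (Num.truncn t).+1 => //.
  by apply: (filtration_mono hF t0) FA; rewrite ltW// truncnS_gt.
move=> n A FA; have mA := filtration_sub hF (nat0 n) FA.
pose H q l := [set w | S (Y z (dy q l) w)].
have FH q l : F (dy q l) (H q l) by exact: (family_adaptedY hY qz (dy_ge0 R q l) mS).
have mH q l : measurable (H q l) by apply: (filtration_sub hF (dy_ge0 R q l)); exact: FH.
have dyn q j : dy q (j * 2 ^ q) = j%:R :> R by rewrite -{1}[q]add0n dyE dy0.
(* Visits to [S] during the time interval from [n] to [n + q], on the grid of mesh [2 ^- q]. Window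
   and grid grow together, so the union over [q] catches a visit at any dyadic time from [n] on. *)
pose U q := hit (H q) (n * 2 ^ q) (q * 2 ^ q).
have mU q : measurable (U q) by exact: measurable_hit.
have step q : p * pr P (A `&` U q) <= pr P (A `&` E).
  apply: (@le_trans _ _ (pr P (A `&` U q `&` E))).
    apply: (@first_hit _ _ _ P (fun l => F (dy q l))) => //.
    - by move=> l; apply: (filtration_sigma hF); exact: dy_ge0.
    - by move=> l B; apply: (filtration_sub hF); exact: dy_ge0.
    - by move=> l; apply: (filtration_mono hF); [exact: dy_ge0|rewrite ler_dy].
    - move=> l B FB BH; apply: (markov_lower qz FB BH _ mD _ (ltW p0) SD).
        by move=> z' [].
      exact: Dshift.
    - by rewrite dyn.
  apply: le_pr; [|exact: measurableI|by move=> w [[]]].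
  by apply: measurableI => //; exact: measurableI.
have ndU q : U q `<=` U q.+1.
  move=> w [l /andP[nl lq] Hl]; exists (l * 2)%N.
    rewrite !expnS !mulnA ![(_ * 2)%N]mulnC -!mulnA !leq_mul2l nl/=.
    rewrite -mulnDr ltn_mul2l/= (leq_trans lq)// leq_add2l leq_mul2r.
    by rewrite leqnSn orbT.
  by rewrite /H/= -[X in dy X _]addn1 -[X in (_ * X)%N](expn1 2) dyE.
have mAUU : measurable (A `&` \bigcup_q U q).
  by apply: measurableI => //; exact: bigcupT_measurable.
have UA : pr P (A `&` \bigcup_q U q) = pr P A.
  apply/eqP; rewrite eq_le; apply/andP; split; first by apply: le_pr => // w [].
  apply: pr_ae_le => //.
  apply: filterS (good_path_ae qz) => w [h x0 cx lln] Aw; split => //.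
  have [|m [l [k [nl yl]]]] := reflected_recurs hr1 hr2 h mu_lt0 (nat0 n) cx.
    by move=> k; apply: lln; rewrite divr_gt0// oppr_gt0.
  pose q := maxn m (Num.truncn (dy m l : R)).+1.
  have mq : (m <= q)%N by exact: leq_maxl.
  have dyl : dy q (l * 2 ^ (q - m)) = dy m l :> R by rewrite -{1}(subnKC mq) dyE.
  exists q => //; exists (l * 2 ^ (q - m))%N.
    apply/andP; split; first by rewrite -(ler_dy R q) dyn dyl.
    rewrite -mulnDl ltnNge -(ler_dy R q) dyl dyn -ltNge.
    apply: (lt_le_trans (truncnS_gt _)); rewrite ler_nat.
    by rewrite (leq_trans (leq_maxr m _))// leq_addl.
  rewrite /H/= dyl; split.
    by apply/quadrantP => k'; apply: (reflected_nonneg h); exact: dy_ge0.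
  by case: k yl => ?; [left|right].
apply/ler_addgt0Pr => e e0.
have e'0 : 0 < e / p by rewrite divr_gt0.
have mAU q : measurable (A `&` U q) by exact: measurableI.
have [q w [Aw /ndU]//|q] := @pr_cvg_bigcup _ _ _ P (fun q => A `&` U q) (e / p) mAU _ e'0.
rewrite -setI_bigcupr UA => hq; have := step q.
have : p * (pr P A - e / p) < p * pr P (A `&` U q) by rewrite ltr_pM2l.
rewrite mulrBr [p * (e / p)]mulrC divfK ?gt_eqF//; lra.
Qed.

Lemma domination_cvg i (z : R -> R * R) (c : R) :
  (forall t, 0 <= t -> quadrant (z t)) -> (forall t, axis i (z t) = t) ->
  (forall t, axis (~~ i) (z t) = c) ->
  pr P (domination_event i (z t)) @[t --> +oo] --> (1 : R).
Proof.
move=> qz zi zj; apply/cvgrPdist_le => e e0.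
have [K K0 HK] := domination_far i e0.
exists (Num.max 0 (K + rho r1 r2 i * c)); split; first exact: num_real.
move=> t; rewrite gt_max => /andP[/ltW t0 /ltW Kt].
have qt := qz t t0.
have := HK _ qt; rewrite zi zj => /(_ Kt).
have := pr_le1 P (measurable_domination_event i qt).
by move=> h1 h2; rewrite ger0_norm ?subr_ge0//; lra.
Qed.

End reflected_family.

Theorem theorem1 (R : realType) (d : measure_display) (T : measurableType d)
    (P : probability T R) (F : R -> set (set T)) (X : R -> T -> R * R)
    (r1 r2 : R) (Y L : R * R -> R -> T -> R * R) (mu1 mu2 : R)
    (hF : filtration F)
    (hX : levy_process P X) (hXF : adapted F X)
    (hr1 : 0 < r1) (hr2 : 0 < r2)
    (hY : reflected_family P F r1 r2 X Y L)
    (hint1 : P.-integrable setT (fun w => (X 1 w).1%:E))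
    (hint2 : P.-integrable setT (fun w => (X 1 w).2%:E))
    (hE1 : ('E_P[fun w => (X 1%R w).1] = mu1%:E)%E)
    (hE2 : ('E_P[fun w => (X 1%R w).2] = mu2%:E)%E)
    (hmu1 : mu1 < 0) (hmu2 : mu2 < 0)
    (hr1mu : `|mu2| < r1 * `|mu1|) (hr2mu : `|mu1| < r2 * `|mu2|)
    (hup12 : (0 < mu_ext P (up_at_infimum (fun t w => (X t w).1)
                                     (fun t w => (X t w).2)))%E)
    (hup21 : (0 < mu_ext P (up_at_infimum (fun t w => (X t w).2)
                                     (fun t w => (X t w).1)))%E) :
  [/\ forall u v : R, 0 <= u -> 0 <= v ->
        (0 < domination1 P Y u v < 1)%E /\
        (domination1 P Y u v + domination2 P Y u v = 1)%E,
      forall v : R, 0 <= v -> domination1 P Y u v @[u --> +oo] --> 1%E &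
      forall u : R, 0 <= u -> domination1 P Y u v @[v --> +oo] --> 0%E].
Proof.
pose mu := (mu1, mu2).
have mu_lt0 i : axis i mu < 0 by case: i.
have drift i : 0 < axis i mu - rho r1 r2 i * axis (~~ i) mu.
  by move: hr1mu hr2mu; rewrite !ltr0_norm//; case: i => /=; lra.
have intX i : P.-integrable setT (fun w => (axis i (X 1 w))%:E) by case: i.
have EX i : \int[P]_w axis i (X 1 w) = axis i mu.
  by move: hE1 hE2; rewrite unlock /Rintegral => h1 h2; case: i => /=; rewrite ?h1 ?h2.
have up i : (0 < mu_ext P (up_at_infimum (fun t w => axis i (X t w))
    (fun t w => axis (~~ i) (X t w))))%E by case: i.
pose p i u v := pr P (domination_event Y i (u, v)).
have qz (u v : R) : 0 <= u -> 0 <= v -> quadrant (u, v) by split.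
have d1E u v : 0 <= u -> 0 <= v -> domination1 P Y u v = (p true u v)%:E.
  by move=> u0 v0; exact: (mu_ext_domination hF hX hY intX EX true (qz u v u0 v0)).
have d2E u v : 0 <= u -> 0 <= v -> domination2 P Y u v = (p false u v)%:E.
  by move=> u0 v0; exact: (mu_ext_domination hF hX hY intX EX false (qz u v u0 v0)).
have total u v : 0 <= u -> 0 <= v -> p true u v + p false u v = 1.
  move=> u0 v0; have q := qz u v u0 v0.
  exact: (domination_total hF hX hXF hr1 hr2 hY mu_lt0 intX drift EX up q).
have pos i u v : 0 <= u -> 0 <= v -> 0 < p i u v.
  move=> u0 v0.
  have [q q0 Hq] := domination_lower hF hX hXF hr1 hr2 hY mu_lt0 intX drift EX
    (up i) (axis (~~ i) (u, v)).
  by apply: lt_le_trans q0 (Hq _ (qz u v u0 v0) _).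
split.
- move=> u v u0 v0; rewrite d1E// d2E// -EFinD total// !lte_fin pos//=; split=> //.
  by have := pos false u v u0 v0; have := total u v u0 v0; lra.
- move=> v v0; apply/fine_cvgP; split.
    by near=> u; rewrite d1E.
  have := domination_cvg hF hX hr1 hr2 hY mu_lt0 intX drift EX (i := true)
    (z := fun u => (u, v)) (c := v) (fun u u0 => qz u v u0 v0) (fun=> erefl) (fun=> erefl).
  apply: cvg_trans; apply: near_eq_cvg; near=> u.
  by rewrite /= d1E.
- move=> u u0; apply/fine_cvgP; split.
    by near=> v; rewrite d1E.
  have := domination_cvg hF hX hr1 hr2 hY mu_lt0 intX drift EX (i := false)
    (z := fun v => (u, v)) (c := u) (fun v v0 => qz u v u0 v0) (fun=> erefl) (fun=> erefl).
  (* By total domination [p_1] is [1 - p_2], and [p_2] tends to 1 by exchanging the coordinates. *)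
  move=> /(cvgB (cvg_cst (1 : R))); rewrite subrr.
  apply: cvg_trans; apply: near_eq_cvg; near=> v.
  have v0 : 0 <= v by [].
  rewrite /= d1E//=; transitivity (1 - p false u v) => //.
  by have := total u v u0 v0; lra.
Unshelve. all: by end_near. Qed.
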